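(* Let $R=\mathbb K[x_1]_p[x_2;\sigma_2,\delta_2]_p\cdots[x_N;\sigma_N,\delta_N]_p$ be a Poisson-CGL extension of length $N$, and $R_k=\mathbb K[x_1,\dots,x_k]$. There exist a function $\eta:[1,N]\to\mathbb Z$ (with predecessor and successor functions $p,s$ for its level sets) and homogeneous elements $c_k\in R_{k-1}$ for all $k\in[2,N]$ with $p(k)\ne-\infty$, such that the elements $y_1,\dots,y_N\in R$ recursively defined by $$y_k:=\begin{cases}y_{p(k)}x_k-c_k,&\text{if }p(k)\neq-\infty\\ x_k,&\text{if }p(k)=-\infty\end{cases}$$ are homogeneous and have the property that for every $k\in[1,N]$, $$\{y_j\mid j\in[1,k],\ s(j)>k\}$$ is a list of the homogeneous Poisson-prime elements of $R_k$ up to scalar multiples. In particular, $y_k$ is a homogeneous Poisson-prime element of $R_k$ as well as a prime element of $R$, for all $k\in[1,N]$. The elements $y_1,\dots,y_N\in R$ with these properties are unique. The function $\eta$ for which there exist homogeneous elements $c_k\in R_{k-1}$ (for $k\in[2,N]$ with $p(k)\neq-\infty$) such that the recursively defined elements $y_1,\dots,y_N$ are homogeneous and, for every $k\in[1,N]$, $\{y_j\mid j\in[1,k],\ s(j)>k\}$ is a list of the homogeneous Poisson-prime elements of $R_k$ up to scalar multiples, is not unique, but the partition of $[1,N]$ into the disjoint union of the level sets of $\eta$ is uniquely determined by $R$ (with its given presentation), as are the predecessor and successor functions $p$ and $s$. The function $p$ has the property that $p(k)=-\infty$ if and only if $\delta_k=0$.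
   Context: $\mathbb K$ is a field of characteristic $0$; algebras are $\mathbb K$-algebras, derivations are $\mathbb K$-linear; $[j,k]=\{j,\dots,k\}$. A Poisson algebra is a commutative algebra with a Lie bracket $\{-,-\}$ that is a derivation in each variable. A Poisson action of a group is an action by algebra automorphisms preserving the bracket. A Poisson derivation $\sigma$ of $B$ is a derivation for both product and bracket; a Poisson $\sigma$-derivation is a derivation $\delta$ for the product with $\delta(\{a,b\})=\{\delta(a),b\}+\{a,\delta(b)\}+\sigma(a)\delta(b)-\delta(a)\sigma(b)$. The Poisson-Ore extension $B[x;\sigma,\delta]_p$ is the polynomial algebra $B[x]$ with the unique Poisson bracket extending that of $B$ and satisfying $\{x,b\}=\sigma(b)x+\delta(b)$. For a rational action of a torus $\mathcal H\cong(\mathbb K^* )^r$, homogeneous elements are the $\mathcal H$-eigenvectors and $0$. $\mathrm{Lie}\,\mathcal H\cong\mathbb K^r$ acts by the differential: if $a$ is an $\mathcal H$-eigenvector with eigenvalue $h\mapsto h_1^{u_1}\cdots h_r^{u_r}$, then $\xi\cdot a=(u_1\xi_1+\dots+u_r\xi_r)a$. A Poisson-prime element of a Poisson algebra $R$ that is a domain is a nonzero $c$ with $\{c,R\}\subseteq Rc$ and $R/(c)$ a domain. A Poisson-CGL extension of length $N$ is an iterated Poisson-Ore extension $R=\mathbb K[x_1]_p[x_2;\sigma_2,\delta_2]_p\cdots[x_N;\sigma_N,\delta_N]_p$ ($\sigma_1=\delta_1=0$; $R_k:=\mathbb K[x_1,\dots,x_k]$, $R_0=\mathbb K$) with a rational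 Poisson action of a torus $\mathcal H$ such that (i) each $x_k$ is an $\mathcal H$-eigenvector; (ii) for $k\in[2,N]$, $\delta_k$ is a locally nilpotent Poisson $\sigma_k$-derivation of $R_{k-1}$; (iii) for $k\in[1,N]$ there is $h_k\in\mathrm{Lie}\,\mathcal H$ with $\sigma_k=(h_k\cdot)|_{R_{k-1}}$ and the $h_k$-eigenvalue $\lambda_k$ of $x_k$ is nonzero. For a function $\eta:[1,N]\to\mathbb Z$: $p(k)=\max\{j<k\mid\eta(j)=\eta(k)\}$ and $s(k)=\min\{j>k\mid\eta(j)=\eta(k)\}$, where $\max\varnothing=-\infty$ and $\min\varnothing=+\infty$. Uniqueness is with respect to the given P-CGL presentation of $R$, not of $R$ as an abstract algebra. *)

(* Defs.v *)
From mathcomp Require Import all_boot all_order all_algebra.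
From mathcomp Require Export mpoly.

Set Implicit Arguments.
Unset Strict Implicit.
Unset Printing Implicit Defensive.

Import GRing.Theory.
Local Open Scope ring_scope.

(* The variables x_1, ..., x_N of the mathematical text are 'X_0, ..., 'X_(N-1)
   with indices in 'I_N.  The subalgebra R_k = K[x_1, ..., x_k] is [Rsub N k],
   k : nat, a subset of {mpoly K[N]}; thus the variable 'X_k is adjoined to
   Rsub N k and produces Rsub N k.+1.  Maps that are only meaningful on some
   R_k are total functions whose values outside R_k are irrelevant. *)

Section Defs.
Variables (K : fieldType) (N : nat).
Local Notation R := {mpoly K[N]}.

Definition Rsub (k : nat) : {pred R} :=
  [pred a : R | all (fun m : 'X_{1..N} =>
                       [forall i : 'I_N, (k <= i)%N ==> (m i == 0%N)])
                    (msupp a)].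

Record poisson_bracket (br : R -> R -> R) : Prop := PoissonBracket {
  br_linearl : forall b, linear (fun a => br a b);
  br_linearr : forall a, linear (br a);
  br_alt : forall a, br a a = 0;
  br_jacobi : forall a b c, br a (br b c) + br b (br c a) + br c (br a b) = 0;
  br_leibnizl : forall a b c, br (a * b) c = a * br b c + br a c * b;
  br_leibnizr : forall a b c, br a (b * c) = br a b * c + b * br a c }.

Record derivation_on (B : {pred R}) (d : R -> R) : Prop := DerivationOn {
  der_stable : forall a, a \in B -> d a \in B;
  der_linear : forall (t : K) a b, a \in B -> b \in B ->
    d (t *: a + b) = t *: d a + d b;
  der_leibniz : forall a b, a \in B -> b \in B ->
    d (a * b) = d a * b + a * d b }.

Definition poisson_derivation_on (br : R -> R -> R) (B : {pred R})
    (sigma : R -> R) : Prop :=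
  derivation_on B sigma /\
  forall a b, a \in B -> b \in B ->
    sigma (br a b) = br (sigma a) b + br a (sigma b).

Definition poisson_sigma_derivation_on (br : R -> R -> R) (B : {pred R})
    (sigma delta : R -> R) : Prop :=
  derivation_on B delta /\
  forall a b, a \in B -> b \in B ->
    delta (br a b) =
      br (delta a) b + br a (delta b) + sigma a * delta b - delta a * sigma b.

Definition locally_nilpotent_on (B : {pred R}) (d : R -> R) : Prop :=
  forall a, a \in B -> exists n : nat, iter n d a = 0.

(* R = K[x_1]_p [x_2; sigma_2, delta_2]_p ... [x_N; sigma_N, delta_N]_p *)
Record iterated_poisson_ore (br : R -> R -> R) (sigma delta : 'I_N -> R -> R)
    : Prop := IteratedPoissonOre {
  ipo_bracket : poisson_bracket br;
  ipo_sigma : forall k : 'I_N, poisson_derivation_on br (Rsub k) (sigma k);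
  ipo_delta : forall k : 'I_N,
    poisson_sigma_derivation_on br (Rsub k) (sigma k) (delta k);
  ipo_first : forall k : 'I_N, k = 0%N :> nat ->
    forall b, b \in Rsub k -> sigma k b = 0 /\ delta k b = 0;
  ipo_rel : forall (k : 'I_N) b, b \in Rsub k ->
    br 'X_k b = sigma k b * 'X_k + delta k b }.

Section Torus.
Variable r : nat.
Local Notation T := {ffun 'I_r -> K}.

Definition torus : {pred T} := [pred h : T | [forall i, h i != 0]].

Definition tchar (u : 'I_r -> int) (h : T) : K := \prod_(i < r) h i ^ u i.

Definition regular_fun (f : T -> K) : Prop :=
  exists s : seq (K * {ffun 'I_r -> int}),
    forall h, h \in torus -> f h = \sum_(t <- s) t.1 * tchar t.2 h.

(* Every element lies in a finite-dimensional stable subspace (with basis e)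
   on which the torus acts through a morphism of algebraic groups. *)
Definition rational_action (act : T -> R -> R) : Prop :=
  forall a : R, exists (n : nat) (e : 'I_n -> R) (M : T -> 'M[K]_n),
    [/\ forall l : 'I_n -> K, \sum_i l i *: e i = 0 -> forall i, l i = 0,
        exists l : 'I_n -> K, a = \sum_i l i *: e i,
        forall i j, regular_fun (fun h => M h i j)
      & forall h, h \in torus -> forall j,
          act h (e j) = \sum_i M h i j *: e i].

Record poisson_torus_action (br : R -> R -> R) (act : T -> R -> R)
    : Prop := PoissonTorusAction {
  act_id : forall a, act [ffun=> 1] a = a;
  act_comp : forall g h, g \in torus -> h \in torus -> forall a,
    act [ffun i => g i * h i] a = act g (act h a);
  act_linear : forall h, h \in torus -> linear (act h);
  act_one : forall h, h \in torus -> act h 1 = 1;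
  act_mul : forall h, h \in torus -> forall a b,
    act h (a * b) = act h a * act h b;
  act_br : forall h, h \in torus -> forall a b,
    act h (br a b) = br (act h a) (act h b);
  act_rational : rational_action act }.

Definition homogeneous (act : T -> R -> R) (a : R) : Prop :=
  exists chi : T -> K, forall h, h \in torus -> act h a = chi h *: a.

Definition has_weight (act : T -> R -> R) (u : 'I_r -> int) (a : R) : Prop :=
  forall h, h \in torus -> act h a = tchar u h *: a.

(* D is the action of xi in Lie H = K^r.  Since R is spanned by eigenvectors
   with rational characters, D exists and is determined by this property. *)
Definition lie_action (act : T -> R -> R) (xi : 'I_r -> K) (D : R -> R)
    : Prop :=
  linear D /\
  forall u a, has_weight act u a -> D a = (\sum_(i < r) xi i *~ u i) *: a.

Record poisson_CGL (br : R -> R -> R) (sigma delta : 'I_N -> R -> R)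
    (act : T -> R -> R) : Prop := PoissonCGL {
  cgl_ore : iterated_poisson_ore br sigma delta;
  cgl_action : poisson_torus_action br act;
  cgl_var : forall k : 'I_N, homogeneous act 'X_k;
  cgl_nilp : forall k : 'I_N, (0 < k)%N ->
    locally_nilpotent_on (Rsub k) (delta k);
  cgl_lie : forall k : 'I_N, exists (xi : 'I_r -> K) (D : R -> R) (lam : K),
    [/\ lie_action act xi D,
        forall b, b \in Rsub k -> sigma k b = D b,
        D 'X_k = lam *: 'X_k
      & lam != 0] }.

End Torus.

Definition in_ideal (B : {pred R}) (c a : R) : Prop :=
  exists2 q, q \in B & a = q * c.

(* B / Bc is a domain, for c in the subalgebra B. *)
Definition quotient_domain (B : {pred R}) (c : R) : Prop :=
  ~ in_ideal B c 1 /\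
  forall a b, a \in B -> b \in B ->
    in_ideal B c (a * b) -> in_ideal B c a \/ in_ideal B c b.

Definition poisson_prime (br : R -> R -> R) (B : {pred R}) (c : R) : Prop :=
  [/\ c \in B, c != 0,
      forall a, a \in B -> in_ideal B c (br c a)
    & quotient_domain B c].

Definition prime_element (c : R) : Prop :=
  [/\ c != 0, c \isn't a GRing.unit
    & forall a b, (exists q, a * b = q * c) ->
        (exists q, a = q * c) \/ (exists q, b = q * c)].

(* [None] stands for -oo (predecessor), resp. +oo (successor). *)

Definition predecessor (eta : 'I_N -> int) (k : 'I_N) : option 'I_N :=
  let A := [set j : 'I_N | (j < k)%N && (eta j == eta k)] in
  [pick j in A | [forall i in A, (i <= j)%N]].

Definition successor (eta : 'I_N -> int) (k : 'I_N) : option 'I_N :=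
  let A := [set j : 'I_N | (k < j)%N && (eta j == eta k)] in
  [pick j in A | [forall i in A, (j <= i)%N]].

Definition succ_gt (eta : 'I_N -> int) (j k : 'I_N) : bool :=
  if successor eta j is Some l then (k < l)%N else true.

Section PrimeSequence.
Variables (r : nat) (br : R -> R -> R) (act : {ffun 'I_r -> K} -> R -> R).

(* The subfamily of y indexed by P lists the homogeneous Poisson-prime elements
   of B up to scalar multiples, without repetition. *)
Definition lists_homogeneous_poisson_primes (B : {pred R}) (P : pred 'I_N)
    (y : 'I_N -> R) : Prop :=
  (forall j, P j -> homogeneous act (y j) /\ poisson_prime br B (y j)) /\
  (forall c, homogeneous act c -> poisson_prime br B c ->
    exists! j, P j /\ exists2 t : K, t != 0 & c = t *: y j).

Record prime_sequence (eta : 'I_N -> int) (c y : 'I_N -> R) : Prop :=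
    PrimeSequence {
  ps_coef : forall k : 'I_N, predecessor eta k <> None ->
    c k \in Rsub k /\ homogeneous act (c k);
  ps_rec : forall k : 'I_N,
    y k = if predecessor eta k is Some j then y j * 'X_k - c k else 'X_k;
  ps_homogeneous : forall k, homogeneous act (y k);
  ps_list : forall k : 'I_N,
    lists_homogeneous_poisson_primes (Rsub k.+1)
      [pred j : 'I_N | (j <= k)%N && succ_gt eta j k] y }.

Definition admissible (eta : 'I_N -> int) : Prop :=
  exists c y : 'I_N -> R, prime_sequence eta c y.

End PrimeSequence.
End Defs.

Arguments Rsub {K} N k.

(* Main.v *)
Require Import Defs.
From mathcomp Require Import all_boot all_order all_algebra.
From mathcomp Require Import ring zify.
From Stdlib Require Import Classical ClassicalEpsilon.

Set Implicit Arguments.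
Unset Strict Implicit.
Unset Printing Implicit Defensive.

Import GRing.Theory.
Local Open Scope ring_scope.

(** The proof constructs, by induction on [k], all homogeneous Poisson-prime
    elements of [R_k] up to scalars, and shows how the list for [R_k.+1] arises
    from the list for [R_k]; the level sets of [eta] merely record this passage.

    Write [x = x_k], [lam] for the eigenvalue of [x], and let [D] be the Lie
    action of [h_k], an Euler operator [sum_i w_i x_i d/dx_i] which extends
    [sigma_k]. The key point is that [delta_k] is inner over the field of
    fractions: there is [d] with [{d, b} = D b * d - delta_k b] for all [b] in
    [R_k], so that [x' = x + d] satisfies [{x', b} = D b * x'].
    This [d] is the divergence of [delta_k] divided by [lam], for the
    logarithmic volume form [dx_0 ... dx_(k-1) / U], where [U] is the product of the
    primes of the list for [R_k]. Indeed the induction also carries the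
    statement that all Hamiltonian vector fields [{-, b}] on [R_k] are
    divergence free for this form ([unimodular]). The condition on [delta_k] to
    be a Poisson [sigma_k]-derivation says that its commutator with [{-, b}] is
    [{-, delta_k b} + delta_k b * D - D b * delta_k]; taking divergences gives
    the identity for [d] ([br_defect]).

    By construction the denominator of [d] divides [U]. Local nilpotence of
    [delta_k] leaves two cases ([exists_pole]): either [d = 0] and
    [delta_k = 0], or the denominator is a single prime [p] of the list, and
    [d = - delta_k p / (lam p)]. The new element is [y = p x'], that is [x] or
    [p x - delta_k p / lam]. It is normal by the identities for [x'], and it is
    prime because it has degree one in [x] with leading coefficient [p] prime to
    its constant term ([new_prime_prime]). All primes of the list other than [p]
    are killed by [delta_k] and remain Poisson-prime, whereas [p] does not.
    Conversely let [c] be a homogeneous Poisson-prime of [R_k.+1] that involves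
    [x]. As derivations, [{x', -} = x' D - lam x'^2 d/dx]; applied to the
    eigenvector [c] of [D] this shows that [c] divides [y^2 * dc/dx], hence that
    [c] divides [y] and is associated to it ([divides_new_prime]).

    The resulting [dichotomy] does not mention any choice, so it determines the
    predecessor function and the elements [y_k] of any sequence as in the
    theorem, and it serves to construct one. *)

(** * Subalgebras generated by the first variables *)

Section PolynomialSubalgebras.
Variables (K : fieldType) (charK : [pchar K] =i pred0) (N : nat).
Local Notation R := {mpoly K[N]}.
Implicit Types (a b c d p q : R) (i j : 'I_N) (k : nat).

Lemma natrK_neq0 n : (n.+1)%:R != 0 :> K.
Proof. by move/pcharf0P: charK => ->. Qed.

Lemma natrR_neq0 n : (n.+1)%:R != 0 :> R.
Proof. by rewrite -mpolyC_nat mpolyC_eq0 natrK_neq0. Qed.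

Lemma mderiv_var i j : ('X_i : R)^`M(j) = (i == j)%:R.
Proof.
rewrite mderivX mnm1E; case: eqVneq => [->|_]; last by rewrite scale0r.
suff -> : (U_(j) - U_(j))%MM = 0%MM by rewrite mpolyX0 scale1r.
by apply/mnmP => l; rewrite mnmBE mnm0E subnn.
Qed.

(** In characteristic zero the subalgebra generated by the first variables is
    cut out by the vanishing of the other partial derivatives, so that closure
    properties reduce to the Leibniz rule. *)
Lemma RsubP k a :
  reflect (forall i, (k <= i)%N -> a^`M(i) = 0) (a \in Rsub N k).
Proof.
apply: (iffP allP) => [a_k i ki | a_k m m_a].
  apply/mpolyP => m; rewrite mcoeff0 mcoeff_deriv.
  have [m_a|] := boolP ((m + U_(i))%MM \in msupp a).
    have /forallP/(_ i) := a_k _ m_a.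
    by rewrite ki /= mnmDE mnm1E eqxx addn1.
  by rewrite -mcoeff_eq0 => /eqP ->; rewrite mul0rn.
apply/forallP => i; apply/implyP => /a_k d_a; apply/negPn/negP => mi0.
have Em : m = (m - U_(i) + U_(i))%MM.
  apply/mnmP => l; rewrite mnmDE mnmBE mnm1E.
  by case: eqVneq => [<-|_]; [rewrite subnK // lt0n | rewrite subn0 addn0].
move/(congr1 (mcoeff (m - U_(i))%MM))/eqP: d_a.
rewrite mcoeff0 mcoeff_deriv -Em -mulr_natr mulf_eq0 (negPf (natrK_neq0 _)).
by rewrite orbF mcoeff_eq0 m_a.
Qed.

Lemma RsubC k (t : K) : t%:MP \in Rsub N k.
Proof. by apply/RsubP => i _; rewrite mderivC. Qed.

Lemma RsubX k i : (i < k)%N -> ('X_i : R) \in Rsub N k.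
Proof.
move=> ik; apply/RsubP => j kj; rewrite mderiv_var.
by case: eqVneq ik => // ->; rewrite ltnNge kj.
Qed.

Lemma RsubD k a b : a \in Rsub N k -> b \in Rsub N k -> a + b \in Rsub N k.
Proof.
by move=> /RsubP Ha /RsubP Hb; apply/RsubP => i ki; rewrite mderivD Ha ?Hb ?addr0.
Qed.

Lemma RsubM k a b : a \in Rsub N k -> b \in Rsub N k -> a * b \in Rsub N k.
Proof.
move=> /RsubP Ha /RsubP Hb; apply/RsubP => i ki.
by rewrite mderivM Ha ?Hb ?mul0r ?mulr0 ?addr0.
Qed.

Lemma RsubZ k (t : K) a : a \in Rsub N k -> t *: a \in Rsub N k.
Proof. by rewrite -mul_mpolyC; apply/RsubM/RsubC. Qed.

Lemma RsubN k a : a \in Rsub N k -> - a \in Rsub N k.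
Proof. by rewrite -scaleN1r; apply: RsubZ. Qed.

Lemma RsubB k a b : a \in Rsub N k -> b \in Rsub N k -> a - b \in Rsub N k.
Proof. by move=> Ha Hb; apply/RsubD/RsubN. Qed.

Lemma Rsub0 k : (0 : R) \in Rsub N k.
Proof. by rewrite -(mpolyC0 N K) RsubC. Qed.

Lemma Rsub1 k : (1 : R) \in Rsub N k.
Proof. by rewrite -(mpolyC1 N K) RsubC. Qed.

Lemma Rsub_sum k (I : Type) (r : seq I) (P : pred I) (F : I -> R) :
  (forall v, P v -> F v \in Rsub N k) -> \sum_(v <- r | P v) F v \in Rsub N k.
Proof. by move=> FR; elim/big_ind: _ => //; [apply: Rsub0 | apply: RsubD]. Qed.

Lemma Rsub_prod k (I : eqType) (r : seq I) (F : I -> R) :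
  (forall v, v \in r -> F v \in Rsub N k) -> \prod_(v <- r) F v \in Rsub N k.
Proof.
move=> FR; rewrite big_seq_cond.
elim/big_ind: _ => [||i /andP[ir _]]; [exact: Rsub1 | exact: RsubM | exact: FR].
Qed.

Lemma Rsub_mderiv k a i : a \in Rsub N k -> a^`M(i) \in Rsub N k.
Proof.
by move=> /RsubP Ha; apply/RsubP => j kj; rewrite mderiv_comm Ha ?mderiv0.
Qed.

Lemma Rsub_le k l a : (k <= l)%N -> a \in Rsub N k -> a \in Rsub N l.
Proof. by move=> kl /RsubP Ha; apply/RsubP => i li; apply/Ha/(leq_trans kl). Qed.

Lemma Rsub_full a : a \in Rsub N N.
Proof. by apply/RsubP => i; have := ltn_ord i; lia. Qed.

Lemma Rsub_pred (k : 'I_N) a : a \in Rsub N k.+1 -> a^`M(k) = 0 -> a \in Rsub N k.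
Proof.
move=> /RsubP Ha ak0; apply/RsubP => i.
by rewrite leq_eqVlt => /predU1P[/val_inj <-|/Ha].
Qed.

(** Divisibility does not depend on the subalgebra in which it is tested. *)
Lemma Rsub_cofactor k q c :
  c != 0 -> c \in Rsub N k -> q * c \in Rsub N k -> q \in Rsub N k.
Proof.
move=> c0 /RsubP Hc /RsubP Hqc; apply/RsubP => i ki; apply: (mulIf c0).
by rewrite mul0r -(Hqc i ki) mderivM (Hc i ki) mulr0 addr0.
Qed.

Lemma Rsub_ind k (P : R -> Prop) :
    (forall t : K, P t%:MP) -> (forall i, (i < k)%N -> P 'X_i) ->
    (forall a b, a \in Rsub N k -> b \in Rsub N k -> P a -> P b -> P (a + b)) ->
    (forall a b, a \in Rsub N k -> b \in Rsub N k -> P a -> P b -> P (a * b)) ->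
  forall a, a \in Rsub N k -> P a.
Proof.
move=> PC PX PD PM a a_k; pose Q b := b \in Rsub N k /\ P b.
suff [] : Q a by [].
have QC t : Q t%:MP by split; [exact: RsubC | exact: PC].
have QD b c : Q b -> Q c -> Q (b + c).
  by move=> [? ?] [? ?]; split; [exact: RsubD | exact: PD].
have QM b c : Q b -> Q c -> Q (b * c).
  by move=> [? ?] [? ?]; split; [exact: RsubM | exact: PM].
rewrite (mpolyE a) big_seq; elim/big_ind: _ => [||m m_a].
- by rewrite -(mpolyC0 N K); apply: QC.
- exact: QD.
rewrite -mul_mpolyC; apply: (QM) => //; rewrite mpolyXE_id.
elim/big_ind: _ => [||i _]; [by rewrite -(mpolyC1 N K) | exact: QM |].
have [ik|ki] := ltnP i k; last first.
  move/allP/(_ m m_a)/forallP/(_ i): a_k; rewrite ki => /eqP ->.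
  by rewrite expr0 -(mpolyC1 N K).
elim: (m i) => [|n IHn]; first by rewrite expr0 -(mpolyC1 N K).
by rewrite exprS; apply: (QM) => //; split; [exact: RsubX | exact: PX].
Qed.

Lemma Rsub0_const a : a \in Rsub N 0 -> exists t : K, a = t%:MP.
Proof.
elim/Rsub_ind => [t|i|b c _ _ [t ->] [u ->]|b c _ _ [t ->] [u ->]] //.
- by exists t.
- by exists (t + u); rewrite mpolyCD.
- by exists (t * u); rewrite mpolyCM.
Qed.

End PolynomialSubalgebras.

(** * Derivations and local nilpotence *)

Section Derivations.
Variables (K : fieldType) (charK : [pchar K] =i pred0) (N : nat).
Local Notation R := {mpoly K[N]}.
Variables (k : nat) (d : R -> R).
Hypothesis der_d : derivation_on (Rsub N k) d.
Local Notation B := (Rsub N k).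
Implicit Types (a b c : R).

Lemma derD a b : a \in B -> b \in B -> d (a + b) = d a + d b.
Proof. by move=> Ba Bb; rewrite -[a]scale1r (der_linear der_d) // !scale1r. Qed.

Lemma der0 : d 0 = 0.
Proof.
by apply: (addrI (d 0)); rewrite -derD ?addr0 //; apply: Rsub0.
Qed.

Lemma derZ t a : a \in B -> d (t *: a) = t *: d a.
Proof.
move=> Ba; rewrite -[t *: a]addr0 (der_linear der_d) // ?der0 ?addr0 //.
exact: Rsub0.
Qed.

Lemma derN a : a \in B -> d (- a) = - d a.
Proof. by move=> Ba; rewrite -scaleN1r derZ // scaleN1r. Qed.

Lemma derB a b : a \in B -> b \in B -> d (a - b) = d a - d b.
Proof. by move=> Ba Bb; rewrite derD ?derN //; apply: RsubN. Qed.

Lemma derC (t : K) : d t%:MP = 0.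
Proof.
have B1 := Rsub1 charK N k.
have -> : t%:MP = t *: 1 :> R by rewrite -mul_mpolyC mulr1.
rewrite derZ //; suff -> : d 1 = 0 by rewrite scaler0.
apply: (addrI (d 1)); rewrite addr0 -[in RHS](mulr1 1).
by rewrite (der_leibniz der_d B1 B1) mulr1 mul1r.
Qed.

Lemma der1 : d 1 = 0.
Proof. by rewrite -(mpolyC1 N K) derC. Qed.

Lemma der_sum (I : Type) (r : seq I) (P : pred I) (F : I -> R) :
  (forall v, P v -> F v \in B) ->
  d (\sum_(v <- r | P v) F v) = \sum_(v <- r | P v) d (F v).
Proof.
move=> BF; elim: r => [|v r IHr]; first by rewrite !big_nil der0.
by rewrite !big_cons; case: ifP => // Pv; rewrite derD ?IHr ?BF ?Rsub_sum.
Qed.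

Lemma der_chain a : a \in B ->
  d a = \sum_(i < N | (i < k)%N) a^`M(i) * d 'X_i.
Proof.
elim/(Rsub_ind charK) => [t|i ik|{}a b Ba Bb IHa IHb|{}a b Ba Bb IHa IHb].
- by rewrite derC big1 // => i _; rewrite mderivC mul0r.
- rewrite (bigD1 i) //= mderiv_var eqxx mul1r big1 ?addr0 // => j /andP[_ ji].
  by rewrite mderiv_var eq_sym (negPf ji) mul0r.
- rewrite derD // IHa IHb -big_split; apply: eq_bigr => i _ /=.
  by rewrite mderivD mulrDl.
rewrite (der_leibniz der_d) // IHa IHb mulr_suml mulr_sumr -big_split.
by apply: eq_bigr => i _ /=; rewrite mderivM; ring.
Qed.

Lemma iter_der_stable n a : a \in B -> iter n d a \in B.
Proof. by move=> Ba; elim: n => //= n; apply: der_stable. Qed.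

Lemma iter_der0 n : iter n d 0 = 0.
Proof. by elim: n => //= n ->; apply: der0. Qed.

Lemma iter_derD n a b : a \in B -> b \in B ->
  iter n d (a + b) = iter n d a + iter n d b.
Proof. by move=> Ba Bb; elim: n => //= n ->; rewrite derD // iter_der_stable. Qed.

Lemma iter_derMl n a b : a \in B -> b \in B -> d a = 0 ->
  iter n d (a * b) = a * iter n d b.
Proof.
move=> Ba Bb da0; elim: n => //= n ->.
by rewrite (der_leibniz der_d) ?iter_der_stable // da0 mul0r add0r.
Qed.

(** All terms but one of the iterated Leibniz formula vanish. *)
Lemma iter_der_top m n a b : a \in B -> b \in B ->
    iter m.+1 d a = 0 -> iter n.+1 d b = 0 ->
  iter (m + n) d (a * b) = 'C(m + n, m)%:R * (iter m d a * iter n d b).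
Proof.
move Es: (m + n)%N => s; elim: s => [|s IHs] in m n a b Es *.
  by case: m n Es => [|m] [|n] //; rewrite bin0 mul1r.
case: m n Es => [|m] [|n] // Es Ba Bb da db.
- by rewrite -Es iter_derMl // bin0 mul1r.
- rewrite mulrC iter_derMl // -Es addn0 binn mul1r /= mulrC.
  by congr (_ * _).
have {}Es : (m.+1 + n)%N = s /\ (m + n.+1)%N = s by lia.
rewrite iterSr (der_leibniz der_d) // iter_derD ?RsubM ?(der_stable der_d) //.
rewrite (IHs m n.+1) ?(der_stable der_d) -?iterSr //; try by case: Es.
rewrite (IHs m.+1 n) ?(der_stable der_d) -?iterSr //; try by case: Es.
by rewrite binS natrD mulrDl addrC.
Qed.

Hypothesis nil_d : locally_nilpotent_on B d.

Lemma lnd_degree a : a \in B -> a != 0 ->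
  exists2 n, iter n d a != 0 & iter n.+1 d a = 0.
Proof.
move=> Ba a0; have ex_n : exists n, iter n d a == 0.
  by have [n /eqP] := nil_d Ba; exists n.
case: (ex_minnP ex_n) => [[|n]] /eqP dn n_min; first by rewrite -dn eqxx in a0.
by exists n => //; apply/negP => /n_min; rewrite ltnn.
Qed.

Lemma lnd_degreeM m n a b : a \in B -> b \in B ->
    iter m d a != 0 -> iter m.+1 d a = 0 ->
    iter n d b != 0 -> iter n.+1 d b = 0 ->
  iter (m + n) d (a * b) != 0.
Proof.
move=> Ba Bb am a0 bn b0; rewrite iter_der_top // !mulf_neq0 //.
have: (0 < 'C(m + n, m))%N by rewrite bin_gt0 leq_addr.
by case: 'C(_, _) => // j _; apply: natrR_neq0.
Qed.

(** Degrees with respect to [d] add up in products, so that a product of degree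
    zero only has factors of degree zero. *)
Lemma lnd_ker_factor a b : a \in B -> b \in B -> a * b != 0 ->
  d (a * b) = 0 -> d a = 0.
Proof.
rewrite mulf_eq0 => Ba Bb /norP[a0 b0] dab; apply/eqP/negPn/negP => da0.
have [[|m] am a1] := lnd_degree Ba a0; first by rewrite [d a]a1 eqxx in da0.
have [n bn b1] := lnd_degree Bb b0.
move/negP: (lnd_degreeM Ba Bb am a1 bn b1); apply.
by rewrite addSn iterSr dab iter_der0.
Qed.

(** If [d a] were nonzero it would have smaller degree than [a], whereas a
    multiple of [a] has at least the degree of [a]. *)
Lemma lnd_eigen a q : a \in B -> q \in B -> d a = q * a -> d a = 0.
Proof.
move=> Ba Bq da; apply/eqP/negPn/negP => da0.
have : q * a != 0 by rewrite -da.
rewrite mulf_eq0 => /norP[q0 a0].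
have [m am a1] := lnd_degree Ba a0; have [n qn q1] := lnd_degree Bq q0.
move/negP: (lnd_degreeM Bq Ba qn q1 am a1); apply.
by rewrite -da -iterSr -addnS iterD a1 iter_der0.
Qed.

Lemma lnd_degree1 a b : a \in B -> b \in B -> a * b != 0 ->
  d (d (a * b)) = 0 -> d a != 0 -> d b = 0.
Proof.
rewrite mulf_eq0 => Ba Bb /norP[a0 b0] ddab da0; apply/eqP/negPn/negP => db0.
have [[|m] am a1] := lnd_degree Ba a0; first by rewrite [d a]a1 eqxx in da0.
have [[|n] bn b1] := lnd_degree Bb b0; first by rewrite [d b]b1 eqxx in db0.
move/negP: (lnd_degreeM Ba Bb am a1 bn b1); apply.
by rewrite addSn addnS !iterSr ddab iter_der0.
Qed.

End Derivations.

Section PartialDerivative.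
Variables (K : fieldType) (charK : [pchar K] =i pred0) (N : nat).
Local Notation R := {mpoly K[N]}.
Implicit Types (a b c p : R) (i : 'I_N).

Lemma mderiv_derivation k i : derivation_on (Rsub N k) (mderiv i : R -> R).
Proof.
split=> [a|t a b _ _|a b _ _]; first exact: Rsub_mderiv.
  by rewrite mderivD mderivZ.
exact: mderivM.
Qed.

Lemma mderiv_nilpotent k i : locally_nilpotent_on (Rsub N k) (mderiv i : R -> R).
Proof.
move=> a _; exists (msize a); rewrite -mderivn_iter mderivnE big_seq big1 // => m ma.
rewrite ffact_small ?mul0r ?scale0r //; apply: leq_ltn_trans (msize_mdeg_lt ma).
by rewrite mdegE (bigD1 i) //= leq_addr.
Qed.

Lemma iter_mderiv_pow i n c : c^`M(i) = 0 ->
  iter n (mderiv i) ('X_i ^+ n * c) = n`!%:R * c.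
Proof.
move=> ci0; elim: n => [|n IHn]; first by rewrite expr0.
have XR : ('X_i : R)^`M(i) = 1 by rewrite mderiv_var eqxx.
have dX m : ('X_i ^+ m.+1 : R)^`M(i) = m.+1%:R * 'X_i ^+ m.
  elim: m => [|m IHm]; first by rewrite expr1 XR expr0 mulr1.
  by rewrite exprS mderivM XR IHm -natr1 !exprS; ring.
rewrite iterSr mderivM ci0 mulr0 addr0 dX -mulrA.
have HN a : a \in Rsub N N := Rsub_full charK a.
rewrite (iter_derMl (mderiv_derivation N i)) ?HN //.
  by rewrite IHn factS natrM mulrA.
by rewrite -mpolyC_nat mderivC.
Qed.

End PartialDerivative.

(** * Divisibility and prime elements *)

Section Divisibility.
Variables (K : fieldType) (charK : [pchar K] =i pred0) (N : nat).
Local Notation R := {mpoly K[N]}.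
Implicit Types (a b c p q : R) (i : 'I_N) (k : nat).

Definition divides c a : Prop := exists q, a = q * c.

Lemma divides_refl a : divides a a.
Proof. by exists 1; rewrite mul1r. Qed.

Lemma divides0 a : divides a 0.
Proof. by exists 0; rewrite mul0r. Qed.

Lemma divides_trans b a c : divides a b -> divides b c -> divides a c.
Proof. by move=> [q ->] [q' ->]; exists (q' * q); rewrite mulrA. Qed.

Lemma dividesD c a b : divides c a -> divides c b -> divides c (a + b).
Proof. by move=> [q ->] [q' ->]; exists (q + q'); rewrite mulrDl. Qed.

Lemma dividesMl c a b : divides c b -> divides c (a * b).
Proof. by move=> [q ->]; exists (a * q); rewrite mulrA. Qed.

Lemma dividesMr c a b : divides c a -> divides c (a * b).
Proof. by rewrite mulrC; apply: dividesMl. Qed.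

Lemma dividesN c a : divides c a -> divides c (- a).
Proof. by rewrite -mulN1r; apply: dividesMl. Qed.

Lemma dividesB c a b : divides c a -> divides c b -> divides c (a - b).
Proof. by move=> ca cb; apply/dividesD/dividesN. Qed.

Lemma dividesZ c t a : divides c a -> divides c (t *: a).
Proof. by rewrite -mul_mpolyC; apply: dividesMl. Qed.

Lemma dividesZr c (t : K) a : t != 0 -> divides c (t *: a) -> divides c a.
Proof. by move=> t0 /(dividesZ t^-1); rewrite scalerA mulVf // scale1r. Qed.

Lemma dividesZl c (t : K) a : t != 0 -> divides c a -> divides (t *: c) a.
Proof.
move=> t0 [q ->]; exists (t^-1 *: q).
by rewrite -scalerAl -scalerAr scalerA mulVf // scale1r.
Qed.

Lemma divides1 c : divides c 1 <-> c \is a GRing.unit.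
Proof.
split=> [[q Eq]|Uc]; last by exists c^-1; rewrite mulVr.
by apply/unitrPr; exists q; rewrite mulrC.
Qed.

Lemma unit_const c : c \is a GRing.unit -> exists2 t : K, t != 0 & c = t%:MP.
Proof.
by case/andP=> /eqP Ec; rewrite unitfE => c0; exists (c@_0%MM).
Qed.

Lemma const_unit (t : K) : t != 0 -> (t%:MP : R) \is a GRing.unit.
Proof.
by move=> t0; apply/unitrPr; exists (t^-1)%:MP; rewrite -mpolyCM mulfV // mpolyC1.
Qed.

Lemma prime_elementM p a b : prime_element p -> divides p (a * b) ->
  divides p a \/ divides p b.
Proof. by case=> _ _; apply. Qed.

Lemma prime_elementZ (t : K) p : t != 0 -> prime_element p ->
  prime_element (t *: p).
Proof.
move=> t0 [p0 pU p_prime]; split.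
- by rewrite scaler_eq0 negb_or t0.
- apply: contra pU => /divides1/(dividesMl t%:MP).
  rewrite mulr1 => /(dividesZl (invr_neq0 t0)).
  rewrite scalerA mulVf // scale1r => [[q Eq]].
  apply/divides1; exists (t^-1 *: q).
  by rewrite -scalerAl -Eq -mul_mpolyC -mpolyCM mulVf // mpolyC1.
move=> a b /(dividesZl (invr_neq0 t0)); rewrite scalerA mulVf // scale1r.
by case/p_prime => /(dividesZl t0); [left | right].
Qed.

Lemma prime_divides_prime p c : prime_element p -> prime_element c ->
  divides c p -> exists2 t : K, t != 0 & c = t *: p.
Proof.
move=> Pp Pc [q Ep]; have [_ cU _] := Pc; have [p0 _ _] := Pp.
have [[u Eu]|[u Eu]] : divides p q \/ divides p c.
- by apply: prime_elementM => //; rewrite -Ep; apply: divides_refl.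
- case/negP: cU; apply/divides1; exists u.
  by apply: (mulIf p0); rewrite mul1r {1}Ep Eu; ring.
have: u \is a GRing.unit.
  by apply/divides1; exists q; apply: (mulIf p0); rewrite mul1r {1}Ep Eu mulrA.
by case/unit_const => t t0 Et; exists t; rewrite // Eu Et mul_mpolyC.
Qed.

Lemma prime_const (t : K) : ~ prime_element (t%:MP : R).
Proof.
case=> t0 /negP tU _; apply: tU; apply: const_unit.
by rewrite -(mpolyC_eq0 N).
Qed.

(** Cancels the denominator of a fraction in lowest terms. *)
Lemma primes_cancel (s : seq R) a z :
    (forall p, p \in s -> prime_element p /\ ~ divides p a) ->
  divides a (\prod_(p <- s) p * z) -> divides a z.
Proof.
elim: s z => [|p s IHs] z Ps; first by rewrite big_nil mul1r.
have [Pp pa] := Ps p (mem_head _ _).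
have {}Ps q : q \in s -> prime_element q /\ ~ divides q a.
  by move=> qs; apply: Ps; rewrite inE qs orbT.
rewrite big_cons -mulrA mulrCA => /(IHs _ Ps) [q Eq].
case: (prime_elementM Pp (a := q) (b := a)) => //.
  by rewrite -Eq; apply/dividesMr/divides_refl.
case=> u Eu; exists u; case: Pp => p0 _ _; apply: (mulfI p0).
by rewrite Eq Eu; ring.
Qed.

(** Puts the fraction with numerator [e] and denominator [prod s] in lowest
    terms. *)
Lemma split_common_primes (s : seq R) e :
  exists s1 s2 e', [/\ perm_eq s (s1 ++ s2), e = e' * \prod_(p <- s2) p
    & forall p, p \in s1 -> ~ divides p e'].
Proof.
elim: s e => [|p s IHs] e; first by exists [::], [::], e; rewrite big_nil mulr1.
have [[q Eq]|pe] := classic (divides p e).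
  have [s1 [s2 [e' [Es Eq' s1e]]]] := IHs q; exists s1, (p :: s2), e'; split=> //.
    by rewrite perm_sym -cat1s perm_catCA perm_cons perm_sym.
  by rewrite big_cons Eq Eq'; ring.
have [s1 [s2 [e' [Es Ee s1e]]]] := IHs e; exists (p :: s1), s2, e'; split=> //.
  by rewrite perm_cons.
move=> q; rewrite inE => /predU1P[->|/s1e] //; apply: contra_not pe => pe'.
by rewrite Ee; apply: dividesMr.
Qed.

Definition prime_in k p : Prop :=
  forall a b, a \in Rsub N k -> b \in Rsub N k -> divides p (a * b) ->
  divides p a \/ divides p b.

(** A prime of [B] stays prime in [B[x]]: split off the leading coefficients,
    which are computed by iterating the partial derivative in [x]. *)
Lemma prime_in_next (k : 'I_N) p : p \in Rsub N k -> prime_in k p ->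
  prime_in k.+1 p.
Proof.
move=> pk Pp a b; set B := Rsub N k.+1; pose d := mderiv k : R -> R.
have dk1 := mderiv_derivation charK k.+1 k.
have dn1 := @mderiv_nilpotent K N k.+1 k.
have dp0 : d p = 0 by apply: (RsubP charK _ _ pk).
have pk1 : p \in B by apply: Rsub_le pk.
have HN c : c \in Rsub N N := Rsub_full charK c.
have divides_iter n c : divides p c -> divides p (iter n d c).
  case=> q ->; exists (iter n d q); rewrite mulrC.
  by rewrite (iter_derMl (mderiv_derivation charK N k)) ?HN // mulrC.
have lower m c : c \in B -> iter m.+1 d c = 0 ->
    exists l, [/\ l = iter m d c, l \in Rsub N k,
       iter m d (c - m`!%:R^-1 *: ('X_k ^+ m * l)) = 0
     & c - m`!%:R^-1 *: ('X_k ^+ m * l) \in B].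
  move=> Bc dc; exists (iter m d c); set l := iter m d c.
  have lB : l \in B by apply: iter_der_stable.
  have lk : l \in Rsub N k by apply: Rsub_pred.
  have XB : 'X_k ^+ m * l \in B.
    apply: RsubM => //; elim: (m) => [|j IHj]; first by rewrite expr0 Rsub1.
    by rewrite exprS RsubM // RsubX.
  split=> //; last by apply: RsubB => //; apply: RsubZ.
  rewrite -scaleNr (iter_derD dk1) ?RsubZ //.
  have dZ u c' j : iter j d (u *: c') = u *: iter j d c'.
    by elim: j => //= j ->; rewrite /d mderivZ.
  rewrite dZ iter_mderiv_pow // -mpolyC_nat mul_mpolyC scalerA mulNr mulVf.
    by rewrite scaleN1r subrr.
  have := fact_gt0 m; case: (m`!) => // j _; exact: natrK_neq0.
suff main s : forall m n, (m + n <= s)%N -> forall a b, a \in B -> b \in B ->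
    iter m d a = 0 -> iter n d b = 0 -> divides p (a * b) ->
    divides p a \/ divides p b.
  move=> Ba Bb; have [m am] := dn1 a Ba; have [n bn] := dn1 b Bb.
  exact: (main (m + n)%N m n (leqnn _)).
elim: s => [|s IHs] m n mns {}a {}b Ba Bb;
  (case: m mns => [|m] mns; first by move=> /= -> *; left; apply: divides0);
  (case: n mns => [|n] mns; first by move=> _ /= -> *; right; apply: divides0);
  move=> am bn pab; first by [].
(* The derivative of order [m + n] of [a * b] is the product of the leading
   coefficients, up to a nonzero integer factor. *)
have [la [Ela lak dla Ba']] := lower m a Ba am.
have [lb [Elb lbk dlb Bb']] := lower n b Bb bn.
have: divides p (la * lb).
  have := divides_iter (m + n)%N _ pab.
  rewrite (iter_der_top charK dk1) // -Ela -Elb -mpolyC_nat mul_mpolyC.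
  apply: dividesZr; have: (0 < 'C(m + n, m))%N by rewrite bin_gt0 leq_addr.
  by case: 'C(_, _) => // j _; apply: natrK_neq0.
case/(Pp _ _ lak lbk) => pl.
- set t := m`!%:R^-1 *: _ in dla Ba'.
  have pt : divides p t by apply/dividesZ/dividesMl.
  have [] : divides p (a - t) \/ divides p b; last by right.
    apply: (IHs m n.+1) => //.
    by rewrite mulrBl; apply: dividesB => //; apply: dividesMr.
  by move/(dividesD pt); rewrite addrC subrK; left.
set t := n`!%:R^-1 *: _ in dlb Bb'.
have pt : divides p t by apply/dividesZ/dividesMl.
have [] : divides p a \/ divides p (b - t); last 1 first.
- by move/(dividesD pt); rewrite addrC subrK; right.
- apply: (IHs m.+1 n) => //; first by rewrite addSn -addnS.
  by rewrite mulrBr; apply: dividesB => //; apply: dividesMl.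
by left.
Qed.

Lemma prime_in_full k p : (k <= N)%N -> p \in Rsub N k -> prime_in k p ->
  forall a b, divides p (a * b) -> divides p a \/ divides p b.
Proof.
move=> kN pk Pp a b; suff: prime_in N p by apply; apply: Rsub_full.
suff H n : (k + n <= N)%N -> prime_in (k + n) p by rewrite -(subnKC kN); apply: H; lia.
elim: n => [|n IHn] knN; first by rewrite addn0.
have knN' : (k + n < N)%N by lia.
rewrite addnS; apply: (@prime_in_next (Ordinal knN')) => /=.
  by apply: (Rsub_le charK _ pk); apply: leq_addr.
by apply: IHn; lia.
Qed.

Lemma in_idealP k c a : c != 0 -> c \in Rsub N k -> a \in Rsub N k ->
  in_ideal (Rsub N k) c a <-> divides c a.
Proof.
move=> c0 ck ak; split=> [[q _ ->]|[q Ea]]; first by exists q.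
by exists q => //; apply: Rsub_cofactor ck _; rewrite // -Ea.
Qed.

Lemma quotient_domainP k c : (k <= N)%N -> c != 0 -> c \in Rsub N k ->
  quotient_domain (Rsub N k) c <-> prime_element c.
Proof.
move=> kN c0 ck; split=> [[c1 Pc]|[_ cU Pc]]; split=> //.
- by apply/negP => /divides1 c1'; apply/c1/in_idealP => //; apply: Rsub1.
- apply: (prime_in_full kN ck) => a b ak bk.
  by move/(in_idealP c0 ck (RsubM charK ak bk))/(Pc _ _ ak bk) => [] /in_idealP; auto.
- by move/(in_idealP c0 ck (Rsub1 charK N k))/divides1; apply/negP.
move=> a b ak bk /(in_idealP c0 ck (RsubM charK ak bk))/Pc [] H; [left|right];
  exact/in_idealP.
Qed.

End Divisibility.

(** * Torus characters and weights *)

Section TorusCharacters.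
Variables (K : fieldType) (r : nat).
Local Notation T := {ffun 'I_r -> K}.
Local Notation H := (@torus K r).
Implicit Types (g h : T) (u v : 'I_r -> int).

Definition torus_mul g h : T := [ffun i => g i * h i].

Lemma torusP h : reflect (forall i, h i != 0) (h \in H).
Proof. exact: forallP. Qed.

Lemma torus_mulP g h : g \in H -> h \in H -> torus_mul g h \in H.
Proof.
by move=> /torusP g0 /torusP h0; apply/torusP => i; rewrite ffunE mulf_neq0.
Qed.

Lemma torus_one : [ffun=> 1] \in H.
Proof. by apply/torusP => i; rewrite ffunE oner_neq0. Qed.

Lemma tcharM u g h : tchar u (torus_mul g h) = tchar u g * tchar u h.
Proof. by rewrite -big_split; apply: eq_bigr => i _; rewrite ffunE expfzMl. Qed.

Lemma tcharD u v h : h \in H ->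
  tchar (fun i => u i + v i) h = tchar u h * tchar v h.
Proof.
by move=> /torusP h0; rewrite -big_split; apply: eq_bigr => i _; rewrite expfzDr.
Qed.

Lemma tchar_neq0 u h : h \in H -> tchar u h != 0.
Proof. by move=> /torusP h0; apply/prodf_neq0 => i _; apply: expfz_neq0. Qed.

(** Independence of characters: subtracting a translate eliminates one term of
    the linear combination. *)
Lemma multiplicative_regular (chi : T -> K) :
    (forall g h, g \in H -> h \in H -> chi (torus_mul g h) = chi g * chi h) ->
    chi [ffun=> 1] = 1 -> regular_fun chi ->
  exists u, forall h, h \in H -> chi h = tchar u h.
Proof.
move=> chiM chi1 [s]; move En: (size s) => n.
elim: n => [|n IHn] in s En *.
  move/size0nil: En => -> /(_ _ torus_one); rewrite big_nil chi1.
  by move/eqP; rewrite oner_eq0.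
case: s En => [|[t u] s] //= [En] Es.
have [chi_u|] := classic (forall h, h \in H -> chi h = tchar u h); first by exists u.
move=> /not_all_ex_not[g] /(@imply_to_and (is_true _)) [gH chi_g].
have d0 : chi g - tchar u g != 0 by rewrite subr_eq0; apply/eqP.
(* Subtract [tchar u g] times the relation at [h] from the relation at [g h]. *)
pose c (v : {ffun 'I_r -> int}) := (tchar v g - tchar u g) / (chi g - tchar u g).
apply: (IHn [seq (w.1 * c w.2, w.2) | w <- s]); first by rewrite size_map.
move=> h hH; apply: (mulfI d0); rewrite mulrBl -chiM // big_map /=.
rewrite [chi h]Es // [chi (torus_mul g h)]Es ?torus_mulP // !big_cons /=.
rewrite tcharM mulrDr opprD addrACA.
rewrite mulrCA subrr add0r !mulr_sumr -sumrB; apply: eq_bigr => w _.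
by rewrite tcharM /c; field.
Qed.

End TorusCharacters.

Section Weights.
Variables (K : fieldType) (charK : [pchar K] =i pred0) (N r : nat).
Local Notation R := {mpoly K[N]}.
Local Notation T := {ffun 'I_r -> K}.
Local Notation H := (@torus K r).
Variables (br : R -> R -> R) (act : T -> R -> R).
Hypothesis act_torus : poisson_torus_action br act.
Implicit Types (a b c : R) (g h : T) (u v : 'I_r -> int).

Lemma actM h a b : h \in H -> act h (a * b) = act h a * act h b.
Proof. by move=> hH; rewrite (act_mul act_torus). Qed.

Lemma actD h a b : h \in H -> act h (a + b) = act h a + act h b.
Proof.
by move=> hH; rewrite -[a]scale1r (act_linear act_torus hH) !scale1r.
Qed.

Lemma act0 h : h \in H -> act h 0 = 0.
Proof. by move=> hH; apply: (addrI (act h 0)); rewrite -actD // !addr0. Qed.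

Lemma actZ h t a : h \in H -> act h (t *: a) = t *: act h a.
Proof.
by move=> hH; rewrite -[t *: a]addr0 (act_linear act_torus hH) act0 // addr0.
Qed.

Lemma act_sum h (I : Type) (s : seq I) (P : pred I) (F : I -> R) : h \in H ->
  act h (\sum_(i <- s | P i) F i) = \sum_(i <- s | P i) act h (F i).
Proof.
move=> hH; elim: s => [|i s IHs]; first by rewrite !big_nil act0.
by rewrite !big_cons; case: ifP => _; rewrite ?actD ?IHs.
Qed.

(** The character of an eigenvector of a rational action is a coordinate of that
    action, hence a monomial by independence of characters. *)
Lemma homogeneous_weight a : homogeneous act a -> exists u, has_weight act u a.
Proof.
have [-> _|a0 [chi chi_a]] := eqVneq a 0.
  by exists (fun=> 0) => h hH; rewrite act0 // scaler0.
have chi_inj t t' : t *: a = t' *: a -> t = t'.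
  move/eqP; rewrite -subr_eq0 -scalerBl scaler_eq0 (negPf a0) orbF subr_eq0.
  by move/eqP.
suff [u chi_u] : exists u, forall h, h \in H -> chi h = tchar u h.
  by exists u => h hH; rewrite chi_a // chi_u.
apply: multiplicative_regular.
- move=> g h gH hH; apply: chi_inj; rewrite -chi_a ?torus_mulP //.
  by rewrite (act_comp act_torus gH hH) !chi_a // actZ // chi_a // scalerA mulrC.
- by apply: chi_inj; rewrite -chi_a ?torus_one // (act_id act_torus) scale1r.
have [n [e [M [e_free [l Ea] M_reg Me]]]] := act_rational act_torus a.
have [i li0] : exists i, l i != 0.
  apply: NNPP => l0; case/eqP: a0; rewrite Ea big1 // => i _.
  by have [->|li] := eqVneq (l i) 0; [rewrite scale0r | case: l0; exists i].
(* The character is a matrix coefficient, hence a regular function. *)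
have chiE h : h \in H -> chi h = (l i)^-1 * \sum_j l j * M h i j.
  move=> hH; apply: (mulfI li0); rewrite mulVKf //.
  apply/eqP; rewrite -subr_eq0; apply/eqP.
  apply: (e_free (fun i => l i * chi h - \sum_j l j * M h i j) _ i).
  transitivity (chi h *: a - act h a); last by rewrite chi_a // subrr.
  rewrite {1}Ea scaler_sumr {1}Ea act_sum // [X in _ - X](_ : _ =
    \sum_i (\sum_j l j * M h i j) *: e i); last first.
    under eq_bigr => j _ do rewrite actZ // Me // scaler_sumr.
    rewrite exchange_big; apply: eq_bigr => m _; rewrite scaler_suml.
    by apply: eq_bigr => j _; rewrite scalerA.
  by rewrite -sumrB; apply: eq_bigr => m _; rewrite scalerBl scalerA mulrC.
have regD (f f' : T -> K) : regular_fun f -> regular_fun f' ->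
    regular_fun (fun h => f h + f' h).
  by move=> [s Es] [s' Es']; exists (s ++ s') => h hH; rewrite big_cat Es ?Es'.
have regZ t (f : T -> K) : regular_fun f -> regular_fun (fun h => t * f h).
  move=> [s Es]; exists [seq (t * w.1, w.2) | w <- s] => h hH.
  by rewrite big_map Es // mulr_sumr; apply: eq_bigr => w _; rewrite mulrA.
suff [s Es] : regular_fun (fun h => (l i)^-1 * \sum_j l j * M h i j).
  by exists s => h hH; rewrite chiE // Es.
apply: (regZ); elim: (index_enum _) => [|j js [s IHjs]].
  by exists [::] => h _; rewrite !big_nil.
have [s' Es'] := regD _ _ (regZ (l j) _ (M_reg i j)) (ex_intro _ s IHjs).
by exists s' => h hH; rewrite big_cons Es'.
Qed.

Lemma weight_homogeneous u a : has_weight act u a -> homogeneous act a.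
Proof. by exists (tchar u). Qed.

Lemma weightM u v a b : has_weight act u a -> has_weight act v b ->
  has_weight act (fun i => u i + v i) (a * b).
Proof.
move=> ua vb h hH; rewrite actM // ua // vb // tcharD //.
by rewrite -scalerAl -scalerAr scalerA.
Qed.

Lemma weightZ u t a : has_weight act u a -> has_weight act u (t *: a).
Proof. by move=> ua h hH; rewrite actZ // ua // !scalerA mulrC. Qed.

Lemma weightD u a b : has_weight act u a -> has_weight act u b ->
  has_weight act u (a + b).
Proof. by move=> ua ub h hH; rewrite actD // ua // ub // scalerDr. Qed.

Lemma weightN u a : has_weight act u a -> has_weight act u (- a).
Proof. by rewrite -scaleN1r; apply: weightZ. Qed.

Lemma weight1 : has_weight act (fun=> 0) 1.
Proof.
move=> h hH; rewrite (act_one act_torus hH) /tchar.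
by rewrite big1 ?scale1r // => i _; rewrite expr0z.
Qed.

Lemma weight_cofactor u v p a : p != 0 -> has_weight act u p ->
  has_weight act (fun i => u i + v i) (p * a) -> has_weight act v a.
Proof.
move=> p0 up upa h hH; have := upa h hH.
rewrite actM // up // tcharD // -scalerAl -scalerA.
by move/(scalerI (tchar_neq0 u hH)); rewrite scalerAr => /(mulfI p0).
Qed.

Lemma weight_br u v a b : has_weight act u a -> has_weight act v b ->
  poisson_bracket br -> has_weight act (fun i => u i + v i) (br a b).
Proof.
move=> ua vb [brl brr _ _ _ _] h hH; rewrite (act_br act_torus) // ua // vb //.
have br0l b' : br 0 b' = 0.
  by have := brl b' 1 0 0; rewrite !scale1r addr0 => E;
     apply: (addrI (br 0 b')); rewrite -E addr0.
have br0r a' : br a' 0 = 0.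
  by have := brr a' 1 0 0; rewrite !scale1r addr0 => E;
     apply: (addrI (br a' 0)); rewrite -E addr0.
rewrite -[tchar u h *: a]addr0 brl br0l addr0.
by rewrite -[tchar v h *: b]addr0 brr br0r addr0 scalerA tcharD.
Qed.

Lemma homogeneousZ t a : homogeneous act a -> homogeneous act (t *: a).
Proof. by case/homogeneous_weight=> u /(weightZ t)/weight_homogeneous. Qed.

End Weights.

(** * Poisson brackets and the Lie action *)

Section Brackets.
Variables (K : fieldType) (charK : [pchar K] =i pred0) (N : nat).
Local Notation R := {mpoly K[N]}.
Variable br : R -> R -> R.
Hypothesis brP : poisson_bracket br.
Implicit Types (a b c : R) (i j : 'I_N) (k n : nat).

Lemma br_anti a b : br a b = - br b a.
Proof.
apply/eqP; rewrite -addr_eq0; apply/eqP.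
have brl c u v : br (u + v) c = br u c + br v c.
  by have := br_linearl brP c 1 u v; rewrite !scale1r.
have brr c u v : br c (u + v) = br c u + br c v.
  by have := br_linearr brP c 1 u v; rewrite !scale1r.
by have := br_alt brP (a + b); rewrite brl !brr !(br_alt brP) add0r addr0.
Qed.

Lemma br_derl b : derivation_on (Rsub N N) (br^~ b).
Proof.
split=> [a _|t a c _ _|a c _ _]; first exact: Rsub_full.
  exact: (br_linearl brP).
by rewrite (br_leibnizl brP) addrC.
Qed.

Lemma br_derr b : derivation_on (Rsub N N) (br b).
Proof.
split=> [a _|t a c _ _|a c _ _]; first exact: Rsub_full.
  exact: (br_linearr brP).
by rewrite (br_leibnizr brP).
Qed.

Lemma brMl a b c : br (a * b) c = a * br b c + br a c * b.
Proof. exact: br_leibnizl. Qed.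

Lemma brMr a b c : br a (b * c) = br a b * c + b * br a c.
Proof. exact: br_leibnizr. Qed.

Lemma brDl a b c : br (a + b) c = br a c + br b c.
Proof. by rewrite (derD (br_derl c)) ?Rsub_full. Qed.

Lemma brDr a b c : br a (b + c) = br a b + br a c.
Proof. by rewrite (derD (br_derr a)) ?Rsub_full. Qed.

Lemma brBl a b c : br (a - b) c = br a c - br b c.
Proof. by rewrite (derB charK (br_derl c)) ?Rsub_full. Qed.

Lemma brZl t a b : br (t *: a) b = t *: br a b.
Proof. by rewrite (derZ charK (br_derl b)) ?Rsub_full. Qed.

Lemma brCl t a : br t%:MP a = 0.
Proof. exact: (derC charK (br_derl a)). Qed.

Lemma brCr t a : br a t%:MP = 0.
Proof. exact: (derC charK (br_derr a)). Qed.

Lemma br0l a : br 0 a = 0.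
Proof. exact: (der0 charK (br_derl a)). Qed.

Lemma br1l a : br 1 a = 0.
Proof. exact: (der1 charK (br_derl a)). Qed.

Lemma divides_br_ind k c :
    (forall i, (i < k)%N -> divides c (br c 'X_i)) ->
  forall a, a \in Rsub N k -> divides c (br c a).
Proof.
move=> cX a; elim/(Rsub_ind charK) => [t|i /cX //|{}a b _ _ ca cb|{}a b _ _ ca cb].
- by rewrite brCr; apply: divides0.
- by rewrite brDr; apply: dividesD.
by rewrite brMr; apply: dividesD; [apply: dividesMr | apply: dividesMl].
Qed.

End Brackets.

Section CGL.
Variables (K : fieldType) (charK : [pchar K] =i pred0) (N r : nat).
Local Notation R := {mpoly K[N]}.
Variables (br : R -> R -> R) (sigma delta : 'I_N -> R -> R).
Variable (act : {ffun 'I_r -> K} -> R -> R).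
Hypothesis RCGL : poisson_CGL br sigma delta act.
Implicit Types (a b c : R) (i j : 'I_N) (k n : nat).

Lemma cgl_bracket : poisson_bracket br.
Proof. exact: (ipo_bracket (cgl_ore RCGL)). Qed.

Lemma br_stable n a b : a \in Rsub N n -> b \in Rsub N n -> br a b \in Rsub N n.
Proof.
have brP := cgl_bracket.
have brXX i j : (i < n)%N -> (j < n)%N -> br 'X_i 'X_j \in Rsub N n.
  wlog ji : i j / (j < i)%N => [hwlog|i_n _].
    case: (ltngtP i j) => [ij i_n j_n|ji i_n j_n|/val_inj -> _ _].
    - by rewrite (br_anti brP); apply/(RsubN charK)/hwlog.
    - exact: hwlog.
    by rewrite (br_alt brP); apply: Rsub0.
  have Xj : ('X_j : R) \in Rsub N i by apply: RsubX.
  have in_n c : c \in Rsub N i -> c \in Rsub N n.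
    by apply: (Rsub_le charK); apply: ltnW.
  rewrite (ipo_rel (cgl_ore RCGL)) //; apply: (RsubD charK).
    apply: (RsubM charK); last exact: RsubX.
    by apply/in_n/(der_stable (ipo_sigma (cgl_ore RCGL) i).1).
  by apply/in_n/(der_stable (ipo_delta (cgl_ore RCGL) i).1).
move=> an bn; elim/(Rsub_ind charK): bn => [t|j jn|{}b c _ _ IHb IHc|{}b c bn cn IHb IHc].
- by rewrite brCr //; apply: Rsub0.
- elim/(Rsub_ind charK): an => [t|i i_n|{}a c _ _ IHb IHc|{}a c an cn IHb IHc].
  + by rewrite brCl //; apply: Rsub0.
  + exact: brXX.
  + by rewrite brDl //; apply: RsubD.
  by rewrite brMl //; apply: RsubD => //; apply: RsubM.
- by rewrite brDr //; apply: RsubD.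
by rewrite brMr //; apply: RsubD => //; apply: RsubM.
Qed.

Lemma poisson_primeP n c : (n <= N)%N ->
  poisson_prime br (Rsub N n) c <->
  [/\ c \in Rsub N n, prime_element c
    & forall a, a \in Rsub N n -> divides c (br c a)].
Proof.
move=> nN; split=> [[cn c0 c_br /(quotient_domainP charK nN c0 cn) Pc]|[cn Pc c_br]].
  split=> // a an; apply/(in_idealP charK c0 cn (br_stable cn an)).
  exact: c_br.
have c0 : c != 0 by case: Pc.
split=> //; last exact/quotient_domainP.
by move=> a an; apply/in_idealP; [| | | exact: br_stable | exact: c_br].
Qed.

(** Monomials are eigenvectors, and on them the Lie action agrees with the Euler
    operator [sum_i w_i x_i d/dx_i], which is a derivation. *)
Lemma lie_action_euler xi D : lie_action act xi D ->
  exists2 w : 'I_N -> K, forall i, D 'X_i = w i *: 'X_i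
    & derivation_on (Rsub N N) D.
Proof.
move=> [D_lin D_wt]; have actP := cgl_action RCGL.
pose ev (u : 'I_r -> int) := \sum_(l < r) xi l *~ u l.
have evD u v : ev (fun l => u l + v l) = ev u + ev v.
  by rewrite -big_split; apply: eq_bigr => i _; rewrite mulrzDr.
have uX i : {u | has_weight act u 'X_i}.
  apply: ClassicalEpsilon.constructive_indefinite_description.
  exact: (homogeneous_weight actP (cgl_var RCGL i)).
pose w i := ev (sval (uX i)); exists w => [i|].
  by rewrite (D_wt _ _ (svalP (uX i))).
pose E a := \sum_i w i *: ('X_i * a^`M(i)) : R.
have DD a b : D (a + b) = D a + D b by have := D_lin 1 a b; rewrite !scale1r.
have D0 : D 0 = 0 by apply: (addrI (D 0)); rewrite -DD !addr0.
have DZ t a : D (t *: a) = t *: D a by have := D_lin t a 0; rewrite D0 !addr0.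
have EM a b : E (a * b) = E a * b + a * E b.
  rewrite /E mulr_suml mulr_sumr -big_split; apply: eq_bigr => i _ /=.
  by rewrite mderivM -!mul_mpolyC; ring.
have ED a b : E (a + b) = E a + E b.
  rewrite /E -big_split; apply: eq_bigr => i _ /=.
  by rewrite mderivD -!mul_mpolyC; ring.
have EZ t a : E (t *: a) = t *: E a.
  rewrite /E scaler_sumr; apply: eq_bigr => i _ /=.
  by rewrite mderivZ -!mul_mpolyC; ring.
have E0 : E 0 = 0 by apply: (addrI (E 0)); rewrite -ED !addr0.
suff DE a : D a = E a by split=> *; rewrite ?Rsub_full ?DE ?ED ?EZ ?EM.
rewrite (mpolyE a); elim: (msupp a) => [|m s IHs]; first by rewrite big_nil D0 E0.
rewrite big_cons DD ED IHs DZ EZ; congr (_ *: _ + _).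
suff [u wu Eu] : exists2 u, has_weight act u 'X_[m] & E 'X_[m] = ev u *: 'X_[m].
  by rewrite Eu (D_wt _ _ wu).
have Q1 : exists2 u, has_weight act u 1 & E 1 = ev u *: 1.
  exists (fun=> 0); first exact: (weight1 actP).
  rewrite /ev big1 ?scale0r; last by move=> i _; rewrite mulr0z.
  by apply: (addrI (E 1)); rewrite addr0 -{3}[1](mulr1 1) EM mul1r mulr1.
have QM a' b : (exists2 u, has_weight act u a' & E a' = ev u *: a') ->
    (exists2 u, has_weight act u b & E b = ev u *: b) ->
    exists2 u, has_weight act u (a' * b) & E (a' * b) = ev u *: (a' * b).
  move=> [u wu Eu] [v wv Ev]; exists (fun l => u l + v l).
    exact: (weightM actP).
  by rewrite EM Eu Ev evD -!mul_mpolyC mpolyCD; ring.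
rewrite mpolyXE_id; elim/big_ind: _ => // i _.
elim: (m i) => [|n IHn]; first by rewrite expr0.
rewrite exprS; apply: QM => //; exists (sval (uX i)); first exact: (svalP (uX i)).
rewrite /E (bigD1 i) //= mderiv_var eqxx mulr1 big1 ?addr0 // => j ji.
by rewrite mderiv_var eq_sym (negPf ji) mulr0 scaler0.
Qed.

End CGL.

(** * Divergence, and the poles of the inner element *)

Section Divergence.
Variables (K : fieldType) (charK : [pchar K] =i pred0) (N : nat).
Local Notation R := {mpoly K[N]}.
Implicit Types (a b c : R) (i j : 'I_N) (k n : nat) (X Y : R -> R).

Definition divergence k X : R := \sum_(i < N | (i < k)%N) (X 'X_i)^`M(i).

Lemma divergence_stable k X : derivation_on (Rsub N k) X ->
  divergence k X \in Rsub N k.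
Proof.
move=> derX; apply: (Rsub_sum charK) => i ik; apply: (Rsub_mderiv charK).
by apply: (der_stable derX); apply: RsubX.
Qed.

(** Expanding [X] and [Y] in partial derivatives, the terms with second
    derivatives give the right-hand side and the others the trace of the product
    of the two Jacobian matrices, which is symmetric in [X] and [Y]. *)
Lemma divergence_commutator k X Y :
    derivation_on (Rsub N k) X -> derivation_on (Rsub N k) Y ->
  \sum_(i < N | (i < k)%N) (X (Y 'X_i) - Y (X 'X_i))^`M(i) =
  X (divergence k Y) - Y (divergence k X).
Proof.
move=> derX derY.
have half Z W : derivation_on (Rsub N k) Z -> derivation_on (Rsub N k) W ->
    \sum_(i < N | (i < k)%N) (Z (W 'X_i))^`M(i) = Z (divergence k W) +
    \sum_(i < N | (i < k)%N) \sum_(j < N | (j < k)%N)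
       (W 'X_i)^`M(j) * (Z 'X_j)^`M(i).
  move=> derZ derW; have WX i : (i < k)%N -> W 'X_i \in Rsub N k.
    by move=> ik; apply: (der_stable derW); apply: RsubX.
  rewrite (der_chain charK derZ) ?divergence_stable // [divergence k W]/divergence.
  under eq_bigr => i ik.
    rewrite (der_chain charK derZ) ?WX // raddf_sum /=.
    under eq_bigr do rewrite mderivM mderiv_comm.
    rewrite big_split; over.
  rewrite big_split /= exchange_big /=; congr (_ + _); apply: eq_bigr => j _.
  by rewrite raddf_sum -mulr_suml.
under eq_bigr do rewrite mderivB.
rewrite sumrB (half X Y) // (half Y X) // [X in _ - (_ + X)]exchange_big /=.
rewrite [X in _ - (_ + X)](_ : _ = \sum_(i < N | (i < k)%N)
  \sum_(j < N | (j < k)%N) (Y 'X_i)^`M(j) * (X 'X_j)^`M(i)); first by ring.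
by apply: eq_bigr => i _; apply: eq_bigr => j _; rewrite mulrC.
Qed.

Lemma divergence_next (k : 'I_N) X :
  divergence k.+1 X = divergence k X + (X 'X_k)^`M(k).
Proof.
rewrite /divergence (bigD1 k) //= addrC; congr (_ + _); apply: eq_bigl => i.
by rewrite ltnS [(i < k)%N]ltn_neqAle andbC.
Qed.

End Divergence.

Section Step.
Variables (K : fieldType) (charK : [pchar K] =i pred0) (N : nat).
Local Notation R := {mpoly K[N]}.
Variables (br : R -> R -> R) (k : 'I_N) (delta D : R -> R) (w : 'I_N -> K).
Local Notation B := (Rsub N k).
Local Notation x := ('X_k : R).
Local Notation L := ((w k)%:MP : R).
Hypothesis brP : poisson_bracket br.
Hypothesis br_stab : forall n (a b : R),
  a \in Rsub N n -> b \in Rsub N n -> br a b \in Rsub N n.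
Hypothesis br_x : forall b, b \in B -> br x b = D b * x + delta b.
Hypothesis D_der : derivation_on (Rsub N N) D.
Hypothesis D_var : forall i, D 'X_i = w i *: 'X_i.
Hypothesis lam0 : w k != 0.
Hypothesis delta_der : derivation_on B delta.
Hypothesis delta_br : forall a b, a \in B -> b \in B ->
  delta (br a b) = br (delta a) b + br a (delta b) + D a * delta b - delta a * D b.
Hypothesis delta_nil : locally_nilpotent_on B delta.
Hypothesis D_delta : forall b, b \in B -> D (delta b) - delta (D b) = w k *: delta b.
Implicit Types (a b c p q e f g U : R) (i j : 'I_N).

Let ham b : R -> R := br^~ b.

(** The vector fields [{-, b}] are divergence free for the volume form
    [dx_0 ... dx_(n-1) / U], after multiplication by [U]. *)
Definition unimodular n U :=
  forall b, b \in Rsub N n -> br U b = U * divergence n (br^~ b).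

Let W : R := (\sum_(i < N | (i < k)%N) w i)%:MP.

Lemma ham_der n b : b \in Rsub N n -> derivation_on (Rsub N n) (ham b).
Proof.
move=> bn; split=> [a an|t a c _ _|a c _ _]; first exact: br_stab.
  exact: (br_linearl brP).
by rewrite /ham (brMl brP) addrC.
Qed.

(** Both sides are derivations in [b]: the bracket terms which prevent
    [b |-> divergence {-, b}] from being one cancel by antisymmetry. *)
Lemma unimodular_ind n V : V \in Rsub N n ->
  (forall i, (i < n)%N -> br V 'X_i = V * divergence n (br^~ 'X_i)) ->
  unimodular n V.
Proof.
move=> Vn VX a; elim/(Rsub_ind charK) => [t|i /VX //|b c bn cn Hb Hc|b c bn cn Hb Hc].
- rewrite (brCr charK brP) /divergence big1 ?mulr0 // => i _.
  by rewrite (brCr charK brP) mderiv0.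
- rewrite (brDr charK brP) Hb Hc -mulrDr; congr (_ * _).
  rewrite -big_split; apply: eq_bigr => i _ /=.
  by rewrite (brDr charK brP) mderivD.
rewrite (brMr brP) Hb Hc.
have -> : divergence n (br^~ (b * c)) =
    divergence n (br^~ b) * c + b * divergence n (br^~ c) + (br c b + br b c).
  have -> : br c b = _ := der_chain charK (ham_der bn) cn.
  have -> : br b c = _ := der_chain charK (ham_der cn) bn.
  rewrite /divergence /ham.
  rewrite mulr_suml mulr_sumr -!big_split; apply: eq_bigr => i _ /=.
  by rewrite (brMr brP) mderivD !mderivM; ring.
by rewrite (br_anti brP c b); ring.
Qed.

Lemma D_mul a b : D (a * b) = D a * b + a * D b.
Proof. by rewrite (der_leibniz D_der) ?Rsub_full. Qed.

Lemma D_stab n a : a \in Rsub N n -> D a \in Rsub N n.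
Proof.
elim/(Rsub_ind charK) => [t|i i_n|b c bn cn IHb IHc|b c bn cn IHb IHc].
- by rewrite (derC charK D_der) Rsub0.
- by rewrite D_var; apply/(RsubZ charK)/RsubX.
- by rewrite (derD D_der) ?Rsub_full // RsubD.
by rewrite D_mul RsubD // RsubM.
Qed.

Lemma D_derB : derivation_on B D.
Proof.
split=> [a aB|t a b _ _|a b _ _]; first exact: D_stab.
  by rewrite (der_linear D_der) ?Rsub_full.
exact: D_mul.
Qed.

(** Divergence of the identity of vector fields
    [[delta, {-, b}] = {-, delta b} + delta b * D - D b * delta], which is the
    defining property of a Poisson sigma-derivation. *)
Lemma divergence_ham_delta b : b \in B ->
  delta (divergence k (ham b)) - br (divergence k delta) b =
  divergence k (ham (delta b)) + W * delta b + L * delta b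
  - D b * divergence k delta.
Proof.
move=> bB; have hb := ham_der bB; have dB := der_stable delta_der.
rewrite -(divergence_commutator charK delta_der hb).
transitivity (\sum_(i < N | (i < k)%N) ((br 'X_i (delta b))^`M(i)
    + ((w i)%:MP * delta b + (delta b)^`M(i) * D 'X_i)
    - ((D b)^`M(i) * delta 'X_i + D b * (delta 'X_i)^`M(i)))).
  apply: eq_bigr => i ik; have XB : ('X_i : R) \in B by apply: RsubX.
  rewrite /ham delta_br // D_var.
  set c := br (delta 'X_i) b; set c' := br 'X_i _.
  have -> : c + c' + w i *: 'X_i * delta b - delta 'X_i * D b - c =
      c' + (w i *: 'X_i * delta b - delta 'X_i * D b) by ring.
  rewrite mderivD mderivB !mderivM mderivZ mderiv_var eqxx.
  by rewrite -!mul_mpolyC mulr1; ring.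
rewrite sumrB !big_split /= -mulr_suml -mulr_sumr.
rewrite -!(der_chain charK D_derB) ?dB // -(der_chain charK delta_der) ?D_stab //.
have <- : D (delta b) - delta (D b) = L * delta b by rewrite D_delta // mul_mpolyC.
rewrite /W raddf_sum /= /divergence /ham; ring.
Qed.

(** [U] times the divergence of [delta] for the volume form [dx_0 ... dx_(k-1) / U]. *)
Definition defect U := U * divergence k delta - delta U.

(** With [d := defect U / (lam U)] the conclusion says
    [{d, b} = D b * d - delta b]: over the field of fractions [delta] is inner. *)
Lemma br_defect U b : U \in B -> unimodular k U -> D U = W * U -> b \in B ->
  br (defect U) b =
  defect U * divergence k (ham b) + D b * defect U - L * U * delta b.
Proof.
move=> UB U_uni DU bB; have dB := der_stable delta_der.
have H1 := divergence_ham_delta bB.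
have HB := divergence_stable charK (ham_der bB).
have H4 : delta (br U b) =
    delta U * divergence k (ham b) + U * delta (divergence k (ham b)).
  by rewrite U_uni // (der_leibniz delta_der).
have H5 := delta_br UB bB.
rewrite /defect (brBl charK brP) (brMl brP).
have -> : br (delta U) b = delta U * divergence k (ham b)
   + U * delta (divergence k (ham b)) - U * divergence k (ham (delta b))
   - W * U * delta b + delta U * D b.
  by rewrite -H4 H5 DU (U_uni _ (dB _ bB)) /ham; ring.
have -> : br (divergence k delta) b = delta (divergence k (ham b))
  - divergence k (ham (delta b)) - W * delta b - L * delta b
  + D b * divergence k delta.
  by rewrite -[br _ _]opprK -[- br _ _](addKr (delta (divergence k (ham b)))) H1; ring.
by rewrite (U_uni _ bB) /ham; ring.
Qed.

Lemma D_mderiv a i : D a^`M(i) = (D a)^`M(i) - w i *: a^`M(i).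
Proof.
have DE c : D c = \sum_j c^`M(j) * (w j *: 'X_j).
  rewrite (der_chain charK D_der) ?Rsub_full //.
  by rewrite big_mkcond; apply: eq_bigr => j _; rewrite ltn_ord D_var.
rewrite !DE raddf_sum /= (bigD1 i) // [in RHS](bigD1 i) //=.
rewrite !mderivM mderivZ mderiv_var eqxx -!mul_mpolyC mulr1.
rewrite [X in _ + X](_ : _ = \sum_(j < N | j != i)
    (a^`M(j) * (w j *: 'X_j))^`M(i)); first by ring.
apply: eq_bigr => j ji; rewrite mderivM mderivZ mderiv_var (negPf ji).
by rewrite scaler0 mulr0 addr0 mderiv_comm.
Qed.

Lemma D_divergence_delta : D (divergence k delta) = w k *: divergence k delta.
Proof.
rewrite /divergence (der_sum charK D_der) => [|i _]; last exact: Rsub_full.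
rewrite scaler_sumr; apply: eq_bigr => i ik; rewrite D_mderiv.
have XB : ('X_i : R) \in B by apply: RsubX.
have -> : D (delta 'X_i) = (w i + w k) *: delta 'X_i.
  apply/eqP; rewrite -(subrK (delta (D 'X_i)) (D _)) D_delta // D_var.
  by rewrite (derZ charK delta_der) // addrC scalerDl.
by rewrite mderivZ scalerDl addrC addKr.
Qed.

Lemma D_defect U t : U \in B -> D U = t *: U ->
  D (defect U) = (t + w k) *: defect U.
Proof.
move=> UB DU; have dUB := der_stable delta_der UB.
have DdU : D (delta U) = (t + w k) *: delta U.
  rewrite -[D _](subrK (delta (D U))) D_delta // DU.
  by rewrite (derZ charK delta_der) // addrC scalerDl.
rewrite /defect (derB charK D_der) ?Rsub_full // D_mul DdU DU D_divergence_delta.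
by rewrite -!mul_mpolyC mpolyCD; ring.
Qed.

Lemma D_eigen_prod (s : seq R) :
    (forall u, u \in s -> exists t : K, D u = t *: u) ->
  exists t : K, D (\prod_(u <- s) u) = t *: \prod_(u <- s) u.
Proof.
elim: s => [|u s IHs] Ds; first by exists 0; rewrite big_nil (der1 charK D_der) scale0r.
have [t Et] := Ds u (mem_head _ _).
have [t' Et'] : exists t : K, D (\prod_(u <- s) u) = t *: \prod_(u <- s) u.
  by apply: IHs => v vs; apply: Ds; rewrite inE vs orbT.
exists (t + t'); rewrite big_cons D_mul Et Et'.
by rewrite -!mul_mpolyC mpolyCD; ring.
Qed.

(** These equations say that [delta] is made inner by [- delta p / (lam p)], and
    that this fraction is [defect U / (lam U)]. The case [p = 1] is that of a
    zero [delta]. *)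
Record pole U p g : Prop := Pole {
  pole_in : p \in B;
  pole_neq0 : p != 0;
  pole_factor : U = p * g;
  pole_defect : defect U = - delta p * g;
  pole_delta2 : delta (delta p) = 0;
  pole_br : forall b, b \in B ->
    p * br (delta p) b - delta p * br p b =
    D b * p * delta p + L * p ^+ 2 * delta b }.

Lemma br_reduced f e g b : g != 0 -> f * g \in B -> unimodular k (f * g) ->
    D (f * g) = W * (f * g) -> defect (f * g) = e * g -> b \in B ->
  f * br e b - e * br f b = D b * e * f - L * f ^+ 2 * delta b.
Proof.
move=> g0 UB U_uni DU Ee bB; have := br_defect UB U_uni DU bB.
have := U_uni b bB; rewrite /ham Ee !(brMl brP) => H1 H2.
have g2 : g ^+ 2 != 0 by rewrite expf_neq0.
apply: (mulfI g2).
transitivity (f * g * (e * br g b + br e b * g)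
  - e * g * (f * br g b + br f b * g)); first by ring.
by rewrite H1 H2; ring.
Qed.

(** With [d := e / (lam f)] the conclusion says [delta d = lam d^2]; it comes
    from [{d, d} = 0]. *)
Lemma delta_reduced f e t : f \in B -> e \in B -> f != 0 ->
    D f = t *: f -> D e = (t + w k) *: e ->
    (forall b, b \in B ->
      f * br e b - e * br f b = D b * e * f - L * f ^+ 2 * delta b) ->
  f * delta e = e * (e + delta f).
Proof.
move=> fB eB f0 Df De red; have := red e eB; have := red f fB.
rewrite !(br_alt brP) Df De (br_anti brP f e) -!mul_mpolyC mpolyCD => H1 H2.
have L0 : L != 0 by rewrite mpolyC_eq0.
have H3 : br e f = t%:MP * e * f - L * f * delta f.
  apply: (mulfI f0); transitivity (f * br e f - e * 0); first by ring.
  by rewrite H1; ring.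
have Lf0 : L * f != 0 by rewrite mulf_neq0.
apply: (mulfI Lf0); set A := (t%:MP + L) * e * e * f.
have H4 : e * br e f = A - L * f ^+ 2 * delta e by rewrite -H2; ring.
transitivity (A - e * br e f); first by rewrite H4; ring.
by rewrite H3 /A; ring.
Qed.

(** The poles of the inner element are simple and there is at most one: in
    lowest terms, with denominator [f] and numerator [e], one gets
    [f * delta e = e * (e + delta f)]; hence [e] divides [delta e], which forces
    [delta e = 0] and then [delta (delta f) = 0], so that the product [f] of
    primes outside the kernel of [delta] has a single factor. *)
Lemma exists_pole (s : seq R) : let U := \prod_(u <- s) u in
    (forall u, u \in s ->
      [/\ u \in B, prime_element u & exists t : K, D u = t *: u]) ->
    unimodular k U -> D U = W * U ->
  (pole U 1 U /\ forall b, b \in B -> delta b = 0) \/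
  (exists p s', [/\ perm_eq s (p :: s'), pole U p (\prod_(u <- s') u)
    & ~ divides p (delta p)]).
Proof.
move=> U Ps U_uni DU.
have UB : U \in B by apply: (Rsub_prod charK) => u /Ps[].
have [s1 [s2 [e [Es Ee s1e]]]] := split_common_primes s (defect U).
have Ps1 u : u \in s1 ->
    [/\ u \in B, prime_element u & exists t : K, D u = t *: u].
  by move=> us1; apply: Ps; rewrite (perm_mem Es) mem_cat us1.
have Ps2 u : u \in s2 ->
    [/\ u \in B, prime_element u & exists t : K, D u = t *: u].
  by move=> us2; apply: Ps; rewrite (perm_mem Es) mem_cat us2 orbT.
set g := \prod_(p <- s2) p in Ee; pose f : R := \prod_(p <- s1) p.
have EU : U = f * g by rewrite /U (perm_big _ Es) big_cat.
have prod_neq0 (s0 : seq R) : (forall u, u \in s0 -> prime_element u) ->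
    \prod_(u <- s0) u != 0.
  by move=> H; rewrite prodf_seq_neq0; apply/allP => u /H[].
have f0 : f != 0 by apply: prod_neq0 => u /Ps1[].
have g0 : g != 0 by apply: prod_neq0 => u /Ps2[].
have fB : f \in B by apply: (Rsub_prod charK) => u /Ps1[].
have gB : g \in B by apply: (Rsub_prod charK) => u /Ps2[].
have defB : defect U \in B.
  apply: (RsubB charK); last exact: (der_stable delta_der).
  by apply: (RsubM charK) => //; apply: divergence_stable.
have eB : e \in B by apply: (Rsub_cofactor charK g0 gB); rewrite -Ee.
have [tf Df] : exists t : K, D f = t *: f by apply: D_eigen_prod => u /Ps1[].
have [tg Dg] : exists t : K, D g = t *: g by apply: D_eigen_prod => u /Ps2[].
have De : D e = (tf + w k) *: e.
  apply: (mulIf g0); apply: (addIr (e * D g)); rewrite -D_mul -Ee.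
  have DU' : D U = (tf + tg) *: U.
    by rewrite EU D_mul Df Dg -!mul_mpolyC mpolyCD; ring.
  by rewrite (D_defect UB DU') Ee Dg -!mul_mpolyC !mpolyCD; ring.
have red b : b \in B ->
    f * br e b - e * br f b = D b * e * f - L * f ^+ 2 * delta b.
  by apply: br_reduced g0 _ _ _ _; rewrite -EU.
have key := delta_reduced fB eB f0 Df De red.
(* In lowest terms, [e] divides [delta e]. *)
have de0 : delta e = 0.
  have [q Eq] : divides e (delta e).
    apply: (@primes_cancel _ _ s1).
      by move=> p ps1; split; [case: (Ps1 p ps1) | apply: s1e].
    by rewrite -/f key; apply/dividesMr/divides_refl.
  have [->|e0] := eqVneq e 0; first exact: (der0 charK delta_der).
  apply: (lnd_eigen charK delta_der delta_nil eB _ Eq).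
  by apply: (Rsub_cofactor charK e0 eB); rewrite -Eq; apply: (der_stable delta_der).
have df : e = - delta f.
  have [e0|e0] := eqVneq e 0; last first.
    apply/eqP; rewrite -addr_eq0; apply/eqP/(mulfI e0).
    by rewrite -key de0 !mulr0.
  case: s1 Es s1e Ps1 @f EU f0 fB Df red key => [|p s1] Es s1e Ps1 f EU f0 fB Df red key.
    by rewrite /f big_nil (der1 charK delta_der) oppr0.
  by case: (s1e p (mem_head _ _)); rewrite e0; apply: divides0.
have ddf : delta (delta f) = 0.
  by rewrite -[delta f]opprK -df (derN charK delta_der) // de0 oppr0.
have pole_f : pole U f g.
  split=> //; first by rewrite Ee df.
  move=> b bB; have := red b bB; rewrite df -scaleN1r.
  rewrite (brZl charK brP) !scaleN1r => H.
  apply: oppr_inj; transitivity (f * - br (delta f) b - - delta f * br f b).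
    by ring.
  by rewrite H; ring.
case: s1 => [|p s1] in Es s1e Ps1 f EU f0 fB Df red key df ddf pole_f *.
  left; have f1 : f = 1 by rewrite /f big_nil.
  have gU : g = U by rewrite EU f1 mul1r.
  split; first by rewrite -f1 -{2}gU.
  move=> b bB; have := red b bB.
  rewrite df f1 (der1 charK delta_der) oppr0 (br0l charK brP) (br1l charK brP).
  rewrite !(mulr0, mul0r, subrr, sub0r, expr1n, mulr1) => /esym/eqP.
  by rewrite eqr_opp mulf_eq0 mpolyC_eq0 (negPf lam0) => /eqP.
right; have [pB Pp _] := Ps1 p (mem_head _ _).
pose f2 : R := \prod_(q <- s1) q.
have Ef : f = p * f2 by rewrite /f big_cons.
have f2B : f2 \in B.
  by apply: (Rsub_prod charK) => q qs; case: (Ps1 q); rewrite // inE qs orbT.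
have dfE : delta f = delta p * f2 + p * delta f2.
  by rewrite Ef (der_leibniz delta_der).
have pe := s1e p (mem_head _ _).
have dp0 : delta p != 0.
  apply/eqP => dp0; apply: pe; rewrite df dfE dp0 mul0r add0r.
  exact/dividesN/dividesMr/divides_refl.
(* [f] has degree at most one with respect to [delta]. *)
have df20 : delta f2 = 0.
  apply: (lnd_degree1 charK delta_der delta_nil pB f2B _ _ dp0); rewrite -Ef //.
case: s1 => [|q s1] in Es s1e Ps1 f EU f0 fB Df red key df ddf pole_f f2 Ef f2B dfE df20 *.
  have fp : f = p by rewrite Ef /f2 big_nil mulr1.
  exists p, s2; split=> //; first by rewrite -fp.
  by move=> pdp; apply: pe; rewrite df fp; apply: dividesN.
have qs : q \in [:: p, q & s1] by rewrite !inE eqxx orbT.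
(* A second factor [q] of [f] would divide [delta f = - e]. *)
case: (s1e q qs); rewrite df dfE df20 mulr0 addr0.
by apply/dividesN/dividesMl; rewrite /f2 big_cons; apply/dividesMr/divides_refl.
Qed.

(** * The Poisson-prime element involving the new variable *)

Section NewPrime.
Variables (U p g : R) (sp : K).
Hypothesis polP : pole U p g.
Hypothesis Dp : D p = sp *: p.
Hypothesis p_normal : forall b, b \in B -> divides p (br p b).
Hypothesis UB : U \in B.
Local Notation B1 := (Rsub N k.+1).

Let pB : p \in B := pole_in polP.
Let dpB : delta p \in B := der_stable delta_der pB.

(** This is [lam] times [p x - delta p / lam]; the factor avoids inverses. *)
Definition new_prime := L * p * x - delta p.
Local Notation y := new_prime.

Let sub_B1 a : a \in B -> a \in B1.
Proof. by apply: (Rsub_le charK). Qed.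

Let x_B1 : x \in B1.
Proof. exact: RsubX. Qed.

Let mderiv_B a : a \in B -> a^`M(k) = 0.
Proof. by move/(RsubP charK); apply. Qed.

Let mderiv_x : x^`M(k) = 1.
Proof. by rewrite mderiv_var eqxx. Qed.

Lemma br_B_x b : b \in B -> br b x = - (D b * x + delta b).
Proof. by move=> bB; rewrite (br_anti brP) br_x. Qed.

Lemma B1_ind (P : R -> Prop) :
    (forall b, b \in B -> P b) -> P x ->
    (forall a b, a \in B1 -> b \in B1 -> P a -> P b -> P (a + b)) ->
    (forall a b, a \in B1 -> b \in B1 -> P a -> P b -> P (a * b)) ->
  forall a, a \in B1 -> P a.
Proof.
move=> PB Px PD PM a; elim/(Rsub_ind charK) => [t|i||] //.
  by apply/PB/RsubC.
rewrite ltnS leq_eqVlt => /predU1P[/val_inj -> //|ik].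
by apply/PB/RsubX.
Qed.

Lemma new_prime_in : y \in B1.
Proof.
apply: (RsubB charK); last exact: sub_B1.
by rewrite !(RsubM charK) ?RsubC // sub_B1.
Qed.

Lemma mderiv_new_prime : y^`M(k) = L * p.
Proof.
rewrite mderivB !mderivM mderivC mderiv_x !mderiv_B //.
by rewrite mulr1; ring.
Qed.

Lemma mderiv_new_prime_neq0 : y^`M(k) != 0.
Proof. by rewrite mderiv_new_prime mulf_neq0 ?mpolyC_eq0 ?(pole_neq0 polP). Qed.

Lemma br_new_prime b q : b \in B -> br p b = q * p -> br y b = (q + D b) * y.
Proof.
move=> bB Eq; apply: (mulfI (pole_neq0 polP)); have := pole_br polP bB.
rewrite /y (brBl charK brP) !(brMl brP) (brCl charK brP) (br_x bB) Eq => H.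
transitivity (p * (L * p * (D b * x + delta b) + L * (q * p) * x)
  - (p * br (delta p) b - delta p * (q * p)) - delta p * (q * p)); first by ring.
by rewrite H; ring.
Qed.

Lemma br_new_prime_x : br y x = - (sp%:MP * x * y).
Proof.
rewrite /y (brBl charK brP) !(brMl brP) (brCl charK brP) (br_alt brP).
rewrite !br_B_x // (pole_delta2 polP).
have -> : D (delta p) = (sp%:MP + L) * delta p.
  rewrite -[D _](subrK (delta (D p))) D_delta // Dp (derZ charK delta_der) //.
  by rewrite -!mul_mpolyC; ring.
by rewrite Dp -!mul_mpolyC; ring.
Qed.

Lemma new_prime_normal a : a \in B1 -> divides y (br y a).
Proof.
elim/B1_ind => [b bB||b c _ _ yb yc|b c _ _ yb yc].
- have [q Eq] := p_normal bB; rewrite (br_new_prime bB Eq).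
  exact/dividesMl/divides_refl.
- by rewrite br_new_prime_x; apply/dividesN/dividesMl/divides_refl.
- by rewrite (brDr charK brP); apply: dividesD.
by rewrite (brMr brP); apply: dividesD; [apply: dividesMr|apply: dividesMl].
Qed.

(** In terms of [x' := y / (lam p)], which satisfies [{x', b} = D b * x'], this
    reads [{x', -} = x' * D - lam * x'^2 * d/dx]. *)
Lemma br_new_prime_euler c : c \in B1 ->
  p * br y c - y * br p c = y * p * D c - y ^+ 2 * c^`M(k).
Proof.
elim/B1_ind => [b bB||b c' _ _ Hb Hc|b c' _ _ Hb Hc].
- have [q Eq] := p_normal bB; rewrite (br_new_prime bB Eq) Eq mderiv_B //; ring.
- rewrite br_new_prime_x br_B_x // Dp D_var mderiv_x -!mul_mpolyC /y; ring.
- rewrite !(brDr charK brP) (derD D_der) ?Rsub_full // mderivD.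
  transitivity ((p * br y b - y * br p b) + (p * br y c' - y * br p c')).
    by ring.
  by rewrite Hb Hc; ring.
rewrite !(brMr brP) D_mul mderivM.
transitivity ((p * br y b - y * br p b) * c' + b * (p * br y c' - y * br p c')).
  by ring.
by rewrite Hb Hc; ring.
Qed.

Lemma divides_new_prime c t : c \in B1 -> D c = t *: c -> prime_element c ->
    (forall a, a \in B1 -> divides c (br c a)) -> c^`M(k) != 0 ->
  divides c y.
Proof.
move=> cB1 Dc Pc c_normal dc.
have c_br a : a \in B1 -> divides c (br a c).
  by move=> aB1; rewrite (br_anti brP); apply/dividesN/c_normal.
have: divides c (y ^+ 2 * c^`M(k)).
  have -> : y ^+ 2 * c^`M(k) = y * p * D c - (p * br y c - y * br p c).
    by rewrite br_new_prime_euler //; ring.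
  apply: dividesB; first by apply/dividesMl; rewrite Dc; apply/dividesZ/divides_refl.
  by apply: dividesB; apply/dividesMl/c_br; [exact: new_prime_in|exact: sub_B1].
case/(prime_elementM Pc) => [/(prime_elementM Pc)[]//|[q Eq]].
case/eqP: dc; apply: (lnd_eigen charK (mderiv_derivation charK N k) _ _ _ Eq).
- exact: mderiv_nilpotent.
- exact: Rsub_full.
exact: Rsub_full.
Qed.

(** [p x] is congruent to an element of [B] modulo [y]. *)
Lemma pseudo_division a : a \in B1 ->
  exists n q r, r \in B /\ p ^+ n * a = q * y + r.
Proof.
elim/B1_ind => [b bB||b c _ _ [n [q [u [uB Eb]]]] [m [q' [v [vB Ec]]]]
                   |b c _ _ [n [q [u [uB Eb]]]] [m [q' [v [vB Ec]]]]].
- by exists 0%N, 0, b; rewrite mul0r add0r expr0 mul1r.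
- exists 1%N, (w k)^-1%:MP, ((w k)^-1%:MP * delta p); split.
    by rewrite (RsubM charK) ?RsubC.
  have LV : (w k)^-1%:MP * L = 1 :> R by rewrite -mpolyCM mulVf // mpolyC1.
  transitivity ((w k)^-1%:MP * L * (p * x)); first by rewrite LV expr1 mul1r.
  by rewrite /y; ring.
- have pnB l : p ^+ l \in B.
    by elim: l => [|l IHl]; [rewrite expr0 Rsub1 | rewrite exprS (RsubM charK)].
  exists (n + m)%N, (p ^+ m * q + p ^+ n * q'), (p ^+ m * u + p ^+ n * v); split.
    by rewrite (RsubD charK) // (RsubM charK).
  transitivity (p ^+ m * (p ^+ n * b) + p ^+ n * (p ^+ m * c)).
    by rewrite exprD; ring.
  by rewrite Eb Ec; ring.
exists (n + m)%N, (q * q' * y + q * v + u * q'), (u * v); split.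
  by rewrite (RsubM charK).
transitivity ((p ^+ n * b) * (p ^+ m * c)); first by rewrite exprD; ring.
by rewrite Eb Ec; ring.
Qed.

(** Up to powers of [p], which can be cancelled because [p] is a prime not
    dividing [y], remainders modulo [y] lie in the domain [B], where only [0] is
    divisible by [y] since [y] involves [x]. *)
Lemma new_prime_prime :
    p = 1 \/ (prime_element p /\ ~ divides p (delta p)) ->
  prime_element y.
Proof.
move=> Pp; have y0 : y != 0.
  by apply: contraNneq mderiv_new_prime_neq0 => ->; rewrite mderiv0.
apply/(quotient_domainP charK (ltn_ord k) y0 new_prime_in); split.
  move/(in_idealP charK y0 new_prime_in (Rsub1 charK _ _))/divides1/unit_const.
  by case=> t _ Ey; have := mderiv_new_prime_neq0; rewrite Ey mderivC eqxx.
suff y_prime a b : a \in B1 -> b \in B1 -> divides y (a * b) ->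
    divides y a \/ divides y b.
  move=> a b aB bB /(in_idealP charK y0 new_prime_in (RsubM charK aB bB)).
  by case/y_prime => // H; [left|right];
     apply/(in_idealP charK y0 new_prime_in).
move=> aB bB yab.
have cancel_p n c : divides y (p ^+ n * c) -> divides y c.
  case: Pp => [->|[Pp pdp]]; first by rewrite expr1n mul1r.
  elim: n => [|n IHn]; first by rewrite expr0 mul1r.
  rewrite exprS -mulrA => ypc; apply: IHn.
  apply: (@primes_cancel _ _ [:: p]); last by rewrite big_seq1.
  move=> q; rewrite inE => /eqP ->; split=> // pdy; apply: pdp.
  have -> : delta p = L * p * x - y by rewrite /y; ring.
  by apply: dividesB => //; apply/dividesMr/dividesMl/divides_refl.
have [n [q [u [uB Ea]]]] := pseudo_division aB.
have [m [q' [v [vB Eb]]]] := pseudo_division bB.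
have uv0 : u * v = 0.
  apply/eqP/negPn/negP => uv0; have [z Ez] : divides y (u * v).
    have -> : u * v = p ^+ n * p ^+ m * (a * b) - (q * q' * y + q * v + u * q') * y.
      transitivity ((p ^+ n * a) * (p ^+ m * b) - (q * q' * y + q * v + u * q') * y).
        by rewrite Ea Eb; ring.
      by ring.
    apply: dividesB; apply: dividesMl => //; exact: divides_refl.
  case/eqP: mderiv_new_prime_neq0.
  apply: (@lnd_ker_factor _ charK _ _ _ (mderiv_derivation charK N k) _ y z).
  - exact: mderiv_nilpotent.
  - exact: Rsub_full.
  - exact: Rsub_full.
  - by rewrite mulrC -Ez.
  by rewrite mulrC -Ez mderiv_B // (RsubM charK).
move/eqP: uv0; rewrite mulf_eq0 => /orP[/eqP u0|/eqP v0]; [left|right].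
  apply: (cancel_p n); rewrite Ea u0 addr0.
  exact/dividesMl/divides_refl.
apply: (cancel_p m); rewrite Eb v0 addr0.
exact/dividesMl/divides_refl.
Qed.

Lemma divergence_ham_next b : b \in B ->
  divergence k.+1 (br^~ b) = divergence k (br^~ b) + D b.
Proof.
move=> bB; rewrite divergence_next br_x // mderivD mderivM mderiv_x.
rewrite !mderiv_B ?D_stab ?(der_stable delta_der) //.
by rewrite mul0r mulr1 add0r addr0.
Qed.

Lemma divergence_ham_x :
  divergence k.+1 (br^~ x) = - (W * x + divergence k delta).
Proof.
rewrite divergence_next (br_alt brP) mderiv0 addr0 /divergence.
rewrite /W raddf_sum mulr_suml -big_split -sumrN; apply: eq_bigr => i ik /=.
have XB : ('X_i : R) \in B by apply: RsubX.
rewrite br_B_x // mderivN mderivD mderivM D_var mderivZ !mderiv_var eqxx.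
have -> : (k == i) = false by apply: contraTF ik => /eqP ->; rewrite ltnn.
by rewrite -mul_mpolyC mulr1 mulr0 addr0.
Qed.

(** Replacing [p] by [y] in the product changes its logarithmic derivative along
    [{-, b}] by [D b], and the divergence of [{-, b}] changes by [D b] as well;
    along [{-, x}] the equality amounts to the expression of [defect U] through
    [p]. *)
Lemma new_unimodular : unimodular k U -> D U = W * U -> unimodular k.+1 (y * g).
Proof.
move=> U_uni DU; have p0 := pole_neq0 polP; have EU := pole_factor polP.
have gB : g \in B by apply: (Rsub_cofactor charK p0 pB); rewrite mulrC -EU.
apply: unimodular_ind => [|i].
  by rewrite (RsubM charK) ?new_prime_in // sub_B1.
rewrite ltnS leq_eqVlt => /predU1P[/val_inj ->|ik].
  rewrite divergence_ham_x (brMl brP) br_new_prime_x br_B_x //.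
  have -> : D g = (W - sp%:MP) * g.
    apply: (mulfI p0); apply: (addrI (D p * g)); rewrite -D_mul -EU DU EU Dp.
    by rewrite -mul_mpolyC; ring.
  have -> : delta g = g * divergence k delta.
    apply: (mulfI p0); apply: (addrI (delta p * g)).
    rewrite -(der_leibniz delta_der) // -EU.
    have := pole_defect polP; rewrite /defect => H.
    transitivity (U * divergence k delta - (U * divergence k delta - delta U)).
      by ring.
    by rewrite H EU; ring.
  by ring.
have XB : ('X_i : R) \in B by apply: RsubX.
have [q Eq] := p_normal XB.
rewrite divergence_ham_next // (brMl brP) (br_new_prime XB Eq).
have -> : br g 'X_i = g * divergence k (br^~ 'X_i) - q * g.
  apply: (mulfI p0); apply: (addIr (br p 'X_i * g)).
  by rewrite -(brMl brP) -EU U_uni // Eq EU; ring.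
by ring.
Qed.

End NewPrime.

End Step.

(** * Lists of homogeneous Poisson-prime elements *)

Section PrimeLists.
Variables (K : fieldType) (charK : [pchar K] =i pred0) (N r : nat).
Local Notation R := {mpoly K[N]}.
Variables (br : R -> R -> R) (sigma delta : 'I_N -> R -> R).
Variable (act : {ffun 'I_r -> K} -> R -> R).
Hypothesis RCGL : poisson_CGL br sigma delta act.
Implicit Types (a b c p : R) (i j : 'I_N) (n : nat) (u v : 'I_r -> int).

Let brP : poisson_bracket br := cgl_bracket RCGL.
Let actP := cgl_action RCGL.
Let br_stab := br_stable charK RCGL.

Definition associated c p := exists2 t : K, t != 0 & c = t *: p.

Definition hprime n c := homogeneous act c /\ poisson_prime br (Rsub N n) c.

Lemma weight_ext u v a : u =1 v -> has_weight act u a -> has_weight act v a.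
Proof.
move=> uv ua h hH; rewrite ua //; congr (_ *: _).
by apply: eq_bigr => l _; rewrite uv.
Qed.

Lemma hprimeP n c : (n <= N)%N ->
  hprime n c <-> [/\ homogeneous act c, c \in Rsub N n, prime_element c
    & forall a, a \in Rsub N n -> divides c (br c a)].
Proof.
move=> nN; split=> [[hc]|[hc cn Pc c_br]].
  by move/(poisson_primeP charK RCGL _ nN) => [].
by split=> //; apply/(poisson_primeP charK RCGL).
Qed.

Lemma hprimeZ n t c : (n <= N)%N -> t != 0 -> hprime n c -> hprime n (t *: c).
Proof.
move=> nN t0 /(hprimeP _ nN)[hc cn Pc c_br]; apply/(hprimeP _ nN); split.
- exact: (homogeneousZ actP).
- exact: (RsubZ charK).
- exact: prime_elementZ.
by move=> a an; rewrite (brZl charK brP); apply/dividesZ/dividesZl/c_br.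
Qed.

Lemma associated_refl c : associated c c.
Proof. by exists 1; rewrite ?oner_neq0 ?scale1r. Qed.

Lemma associated_sym c p : associated c p -> associated p c.
Proof.
move=> [t t0 ->]; exists t^-1; first by rewrite invr_neq0.
by rewrite scalerA mulVf // scale1r.
Qed.

Lemma associated_trans p c q : associated c p -> associated p q -> associated c q.
Proof.
move=> [t t0 ->] [z z0 ->]; exists (t * z); first by rewrite mulf_neq0.
by rewrite scalerA.
Qed.

(** Here [D] is the Lie action of [h_k], which replaces [sigma k] because it is
    defined on all of [R], and [ev] pairs characters with [h_k]. *)
Record step_data (k : 'I_N) (D : R -> R) (w : 'I_N -> K)
    (ev : ('I_r -> int) -> K) : Prop := StepData {
  sd_der : derivation_on (Rsub N N) D;
  sd_var : forall i, D 'X_i = w i *: 'X_i;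
  sd_lam : w k != 0;
  sd_ev : forall u a, has_weight act u a -> D a = ev u *: a;
  sd_br : forall b, b \in Rsub N k -> br 'X_k b = D b * 'X_k + delta k b;
  sd_delta : derivation_on (Rsub N k) (delta k);
  sd_delta_br : forall a b, a \in Rsub N k -> b \in Rsub N k ->
    delta k (br a b) =
    br (delta k a) b + br a (delta k b) + D a * delta k b - delta k a * D b;
  sd_nil : locally_nilpotent_on (Rsub N k) (delta k);
  sd_weight : forall u v b, has_weight act u 'X_k -> b \in Rsub N k ->
    has_weight act v b -> has_weight act (fun l => u l + v l) (delta k b);
  sd_D_delta : forall b, b \in Rsub N k ->
    D (delta k b) - delta k (D b) = w k *: delta k b }.

Lemma step_data_exists k : exists D w ev, step_data k D w ev.
Proof.
have [xi [D [lam [Dlie sigmaD Dx lam0]]]] := cgl_lie RCGL k.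
have [w Dw Dder] := lie_action_euler charK RCGL Dlie.
pose ev u := \sum_(l < r) xi l *~ u l.
have evP u a : has_weight act u a -> D a = ev u *: a by apply: Dlie.2.
have x0 : 'X_k != 0 :> R.
  apply/eqP => /(congr1 (mderiv k)); rewrite mderiv_var eqxx mderiv0 => /eqP.
  by rewrite oner_eq0.
have wk : w k = lam.
  apply/eqP; rewrite -subr_eq0; have /eqP := Dw k.
  by rewrite Dx eq_sym -subr_eq0 -scalerBl scaler_eq0 (negPf x0) orbF.
have ore := cgl_ore RCGL; have [dder dbr] := ipo_delta ore k.
have brx b : b \in Rsub N k -> br 'X_k b = D b * 'X_k + delta k b.
  by move=> bB; rewrite (ipo_rel ore) // sigmaD.
have dweight u v b : has_weight act u 'X_k -> b \in Rsub N k ->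
    has_weight act v b -> has_weight act (fun l => u l + v l) (delta k b).
  move=> ux bB vb.
  have -> : delta k b = br 'X_k b + - (ev v *: ('X_k * b)).
    by rewrite brx // (evP _ _ vb) -!mul_mpolyC; ring.
  apply: (weightD actP); first exact: (weight_br actP).
  by apply/(weightN actP)/(weightZ actP)/(weightM actP).
exists D, w, ev; split=> //; first by rewrite wk.
- by move=> a b aB bB; rewrite dbr // !sigmaD.
- have [k0|k0] := posnP k; last exact: (cgl_nilp RCGL).
  move=> a; rewrite k0 => /(Rsub0_const charK)[t ->]; exists 1%N.
  exact: (derC charK dder).
move=> b bB; have dk := der_stable dder.
have Dst a : a \in Rsub N k -> D a \in Rsub N k by apply: (D_stab charK Dder Dw).
have DD a c : D (a + c) = D a + D c by rewrite (derD Dder) ?Rsub_full.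
have DM a c : D (a * c) = D a * c + a * D c.
  by rewrite (der_leibniz Dder) ?Rsub_full.
(* Both sides are derivations; on variables, compare weights. *)
elim/(Rsub_ind charK): bB => [t|i ik|{}b c bB cB Hb Hc|{}b c bB cB Hb Hc].
- rewrite (derC charK dder) (derC charK Dder) (der0 charK Dder).
  by rewrite (der0 charK dder) subrr scaler0.
- have XB : ('X_i : R) \in Rsub N k by apply: RsubX.
  have [u ux] := homogeneous_weight actP (cgl_var RCGL k).
  have [v vx] := homogeneous_weight actP (cgl_var RCGL i).
  have ev_k : ev u *: 'X_k = w k *: 'X_k :> R by rewrite -(evP _ _ ux) Dw.
  have ev_ku : ev u = w k.
    apply/eqP; rewrite -subr_eq0; move/eqP: ev_k.
    by rewrite -subr_eq0 -scalerBl scaler_eq0 (negPf x0) orbF.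
  rewrite (evP _ _ (dweight _ _ _ ux XB vx)) (evP _ _ vx) (derZ charK dder) //.
  rewrite -scalerBl -ev_ku /ev -sumrB; congr (_ *: _).
  by apply: eq_bigr => l _; rewrite mulrzDr addrK.
- rewrite !(DD, derD dder) ?dk ?Dst // scalerDr -Hb -Hc; ring.
rewrite (der_leibniz dder) // !(DD, DM) (derD dder) ?RsubM ?Dst //.
rewrite !(der_leibniz dder) ?Dst //.
transitivity ((D (delta k b) - delta k (D b)) * c
  + b * (D (delta k c) - delta k (D c))); first by ring.
by rewrite Hb Hc -!mul_mpolyC; ring.
Qed.

(** The last two fields concern the logarithmic volume form
    [dx_0 ... dx_(n-1) / prod_(p <- s) p]: it is preserved by the Hamiltonian vector
    fields and by the torus. *)
Record prime_list n (s : seq R) : Prop := PrimeList {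
  pl_prime : forall p, p \in s -> hprime n p;
  pl_complete : forall c, hprime n c -> exists2 p, p \in s & associated c p;
  pl_uniq : uniq s;
  pl_assoc : forall p q, p \in s -> q \in s -> associated p q -> p = q;
  pl_unimodular : unimodular br n (\prod_(p <- s) p);
  pl_weight : exists2 u, has_weight act u (\prod_(p <- s) p)
    & has_weight act u (\prod_(i < N | (i < n)%N) 'X_i) }.

Lemma prime_list0 : prime_list 0 [::].
Proof.
split=> //.
- move=> c /(hprimeP _ (leq0n N))[_ /(Rsub0_const charK)[t ->] Pt _].
  by case: (prime_const Pt).
- move=> b _; rewrite big_nil mul1r (br1l charK brP) /divergence.
  by rewrite big_pred0.
exists (fun=> 0); rewrite ?big_nil ?big_pred0 //; exact: (weight1 actP).
Qed.

(** Phrased up to association, without the lists, so that it applies to any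
    sequence of elements. *)
Definition dichotomy (k : 'I_N) : Prop :=
  [/\ forall b, b \in Rsub N k -> delta k b = 0,
      hprime k.+1 'X_k,
      forall c, hprime k c -> hprime k.+1 c
    & forall c, hprime k.+1 c -> associated c 'X_k \/ hprime k c] \/
  exists p c0, let y := p * 'X_k - c0 in
  [/\ hprime k p /\ delta k p <> 0,
      c0 \in Rsub N k /\ homogeneous act c0,
      hprime k.+1 y,
      forall c, hprime k c -> ~ associated c p -> hprime k.+1 c
    & forall c, hprime k.+1 c ->
        associated c y \/ (hprime k c /\ ~ associated c p)].

Section OneStep.
Variables (k : 'I_N) (s : seq R) (D : R -> R) (w : 'I_N -> K).
Variables (ev : ('I_r -> int) -> K).
Hypothesis sd : step_data k D w ev.
Hypothesis sP : prime_list k s.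
Local Notation B := (Rsub N k).
Local Notation B1 := (Rsub N k.+1).
Local Notation dk := (delta k).
Let U := \prod_(p <- s) p.
Let kN : (k <= N)%N := ltnW (ltn_ord k).

Lemma hprime_B p : hprime k p ->
  [/\ p \in B, prime_element p & exists t : K, D p = t *: p].
Proof.
case/(hprimeP _ kN) => /(homogeneous_weight actP)[u pu] pB Pp _; split=> //.
by exists (ev u); apply: (sd_ev sd).
Qed.

Lemma prod_in_B : U \in B.
Proof. by apply: (Rsub_prod charK) => p /(pl_prime sP)/hprime_B[]. Qed.

Lemma D_prod : D U = (\sum_(i < N | (i < k)%N) w i)%:MP * U.
Proof.
have [u uU uX] := pl_weight sP; rewrite mul_mpolyC (sd_ev sd uU); congr (_ *: _).
have DX (I : seq 'I_N) (P : pred 'I_N) : D (\prod_(i <- I | P i) 'X_i) =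
    (\sum_(i <- I | P i) w i) *: \prod_(i <- I | P i) 'X_i.
  elim: I => [|i I IHI]; first by rewrite !big_nil (der1 charK (sd_der sd)) scale0r.
  rewrite !big_cons; case: ifP => // _.
  rewrite (D_mul charK (sd_der sd)) IHI (sd_var sd) -!mul_mpolyC mpolyCD; ring.
have /eqP := DX (index_enum _) [pred i : 'I_N | (i < k)%N].
rewrite (sd_ev sd uX) -subr_eq0 -scalerBl scaler_eq0 subr_eq0 => /orP[/eqP //|].
move=> /prodf_eq0[i _] /eqP.
move=> /(congr1 (mderiv i)); rewrite mderiv_var eqxx mderiv0 => /eqP.
by rewrite oner_eq0.
Qed.

Lemma hprime_next p : hprime k p -> divides p (dk p) -> hprime k.+1 p.
Proof.
move=> hp pdp; have [pB Pp [t Dp]] := hprime_B hp.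
have [hom_p _ _ p_br] := (hprimeP p kN).1 hp.
apply/hprimeP => //; split=> //; first exact: (Rsub_le charK (leqnSn k) pB).
apply: (divides_br_ind charK brP) => i; rewrite ltnS leq_eqVlt.
case/predU1P=> [/val_inj ->|ik]; last by apply/p_br/RsubX.
rewrite (br_anti brP) (sd_br sd) // Dp; apply/dividesN/dividesD => //.
by apply/dividesMr/dividesZ/divides_refl.
Qed.

Lemma hprime_prev c : hprime k.+1 c -> c^`M(k) = 0 -> hprime k c /\ divides c (dk c).
Proof.
case/hprimeP => // hc cB1 Pc c_br dc; have cB := Rsub_pred charK cB1 dc.
have hpc : hprime k c.
  by apply/hprimeP => //; split=> // a aB; apply/c_br/(Rsub_le charK _ aB).
split=> //; have [_ _ [t Dc]] := hprime_B hpc.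
have -> : dk c = - br c 'X_k - D c * 'X_k.
  by rewrite (br_anti brP) (sd_br sd) //; ring.
apply: dividesB; first by apply/dividesN/c_br/RsubX.
by rewrite Dc; apply/dividesMr/dividesZ/divides_refl.
Qed.

Section NewVariable.
Variables (p : R) (s' : seq R).
Hypothesis polP : pole br k dk D w U p (\prod_(q <- s') q).
Hypothesis s's : {subset s' <= s}.
Hypothesis uniq_s' : uniq s'.
Hypothesis ps : p = 1 \/ (hprime k p /\ ~ divides p (dk p)).
Hypothesis s'_dk : forall q, q \in s' -> divides q (dk q).
Hypothesis s_dk : forall q, q \in s -> q \notin s' -> ~ divides q (dk q).
Let y := new_prime k dk w p.

Let hom_p : homogeneous act p.
Proof.
case: ps => [->|[[] //]]; apply: weight_homogeneous; exact: (weight1 actP).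
Qed.

Let p_normal b : b \in B -> divides p (br p b).
Proof.
case: ps => [->|[/(hprimeP _ kN)[_ _ _ p_br] _]]; last exact: p_br.
by move=> _; rewrite (br1l charK brP); apply: divides0.
Qed.

Let Dp : exists t : K, D p = t *: p.
Proof.
have [u pu] := homogeneous_weight actP hom_p.
by exists (ev u); apply: (sd_ev sd).
Qed.

Let pB : p \in B := pole_in polP.

Lemma weight_new_prime u v : has_weight act u 'X_k -> has_weight act v p ->
  has_weight act (fun l => u l + v l) y.
Proof.
move=> ux vp; rewrite /y /new_prime; apply: (weightD actP).
  apply: (weight_ext (u := fun l => v l + u l)) => [l|]; first exact: addrC.
  by apply: (weightM actP) => //; rewrite mul_mpolyC; apply: (weightZ actP).
by apply/(weightN actP)/(sd_weight sd).
Qed.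

Lemma hprime_new_prime : hprime k.+1 y.
Proof.
have [t Dpt] := Dp; apply/hprimeP => //; split.
- have [u ux] := homogeneous_weight actP (cgl_var RCGL k).
  have [v vp] := homogeneous_weight actP hom_p.
  exact: weight_homogeneous (weight_new_prime ux vp).
- exact: (new_prime_in charK (sd_delta sd) polP).
- apply: (new_prime_prime charK (sd_lam sd) (sd_delta sd) polP).
  case: ps => [|[/hprime_B[_ Pp _] pdp]]; [by left | by right].
exact: (new_prime_normal charK brP (sd_br sd) (sd_delta sd) (sd_D_delta sd)
  polP Dpt p_normal).
Qed.

Lemma hprime_new_cases c : hprime k.+1 c ->
  associated c y \/ exists2 q, q \in s' & associated c q.
Proof.
move=> hc; have [dc|dc] := eqVneq c^`M(k) 0.
  right; have [hkc cdc] := hprime_prev hc dc.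
  have [q qs [t t0 Ec]] := pl_complete sP hkc; exists q; last by exists t.
  apply/negPn/negP => qs'; apply: (s_dk qs qs').
  have [qB _ _] := hprime_B (pl_prime sP qs).
  have cq : divides q c by rewrite Ec; apply/dividesZ/divides_refl.
  apply: (divides_trans cq); move: cdc; rewrite Ec (derZ charK (sd_delta sd)) //.
  exact: dividesZr.
left; have [t Dpt] := Dp; have [hom_c cB1 Pc c_br] := (hprimeP c (ltn_ord k)).1 hc.
have [_ _ Py _] := (hprimeP y (ltn_ord k)).1 hprime_new_prime.
have [v cv] := homogeneous_weight actP hom_c.
apply: (prime_divides_prime Py Pc).
exact: (divides_new_prime charK brP (sd_br sd) (sd_der sd) (sd_var sd)
  (sd_delta sd) (sd_D_delta sd) polP Dpt p_normal cB1 (sd_ev sd cv) Pc c_br dc).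
Qed.

Lemma new_prime_not_associated q : q \in B -> ~ associated y q.
Proof.
move=> /(RsubP charK)/(_ k (leqnn k)) dq [t t0 Ey].
have /eqP := mderiv_new_prime_neq0 charK (sd_lam sd) (sd_delta sd) polP.
by apply; rewrite -/y Ey mderivZ dq scaler0.
Qed.

Lemma prime_list_new : prime_list k.+1 (y :: s').
Proof.
have s'B q : q \in s' -> q \in B by move/s's/(pl_prime sP)/hprime_B => [].
split.
- move=> q; rewrite inE => /predU1P[->|qs']; first exact: hprime_new_prime.
  by apply: hprime_next (s'_dk qs'); apply/(pl_prime sP)/s's.
- move=> c /hprime_new_cases[cy|[q qs' cq]]; first by exists y; rewrite ?mem_head.
  by exists q; rewrite // inE qs' orbT.
- rewrite /= uniq_s' andbT; apply/negP => /s'B yB.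
  exact: (new_prime_not_associated yB (associated_refl y)).
- move=> q q'; rewrite !inE => /predU1P[->|qs'] /predU1P[->|q's'] // qq'.
  + by case: (new_prime_not_associated (s'B _ q's') qq').
  + by case: (new_prime_not_associated (s'B _ qs') (associated_sym qq')).
  exact: (pl_assoc sP (s's qs') (s's q's') qq').
- rewrite big_cons; have [t Dpt] := Dp.
  exact: (new_unimodular charK brP br_stab (sd_br sd) (sd_der sd) (sd_var sd)
    (sd_delta sd) (sd_D_delta sd) polP Dpt p_normal prod_in_B
    (pl_unimodular sP) D_prod).
have [u uU uX] := pl_weight sP.
have [ux x_ux] := homogeneous_weight actP (cgl_var RCGL k).
have [v vp] := homogeneous_weight actP hom_p.
exists (fun l => ux l + u l); last first.
  rewrite (bigD1 k) //=; apply: (weightM actP x_ux).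
  rewrite (eq_bigl (fun i : 'I_N => (i < k)%N)) // => i.
  by rewrite ltnS [(i < k)%N]ltn_neqAle andbC.
rewrite big_cons; apply: (weight_ext (u := fun l => (ux l + v l) + (u l - v l))).
  by move=> l; ring.
apply: (weightM actP); first exact: weight_new_prime.
apply: (weight_cofactor actP (pole_neq0 polP) vp); rewrite -(pole_factor polP).
by apply: weight_ext uU => l; ring.
Qed.

End NewVariable.

Lemma one_step : (exists s', prime_list k.+1 s') /\ dichotomy k.
Proof.
have sB p : p \in s ->
    [/\ p \in B, prime_element p & exists t : K, D p = t *: p].
  by move/(pl_prime sP)/hprime_B.
have [[pol1 dk0]|[p [s' [Es polP pdp]]]] :=
  exists_pole charK brP br_stab (sd_der sd) (sd_var sd) (sd_lam sd)
    (sd_delta sd) (sd_delta_br sd) (sd_nil sd) (sd_D_delta sd)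
    sB (pl_unimodular sP) D_prod.
  have q_dk q : q \in s -> divides q (dk q).
    by move=> qs; case: (sB q qs) => qB _ _; rewrite dk0 //; apply: divides0.
  have s_dk q : q \in s -> q \notin s -> ~ divides q (dk q) by move=> ->.
  have Ey : new_prime k dk w 1 = w k *: 'X_k.
    by rewrite /new_prime (der1 charK (sd_delta sd)) subr0 mulr1 mul_mpolyC.
  have ps : 1 = 1 :> R \/ (hprime k 1 /\ ~ divides 1 (dk 1)) by left.
  split.
    exists (new_prime k dk w 1 :: s).
    exact: (prime_list_new pol1 (fun _ => id) (pl_uniq sP) ps q_dk s_dk).
  left; split=> //.
  - rewrite -[X in hprime _ X]scale1r -(mulVf (sd_lam sd)) -scalerA -Ey.
    apply: hprimeZ; rewrite ?invr_eq0 ?(sd_lam sd) //.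
    exact: (hprime_new_prime pol1 ps).
  - move=> c hc; apply: hprime_next => //; case/hprime_B: hc => cB _ _.
    by rewrite dk0 //; apply: divides0.
  move=> c /(hprime_new_cases pol1 ps s_dk)[cy|[q qs [t t0 ->]]]; [left|right].
    apply: associated_trans cy _; rewrite Ey.
    by exists (w k); rewrite ?(sd_lam sd).
  by apply: hprimeZ => //; apply: (pl_prime sP).
have /andP[ps' uniq_s'] : uniq (p :: s') by rewrite -(perm_uniq Es) (pl_uniq sP).
have s's : {subset s' <= s} by move=> q qs'; rewrite (perm_mem Es) inE qs' orbT.
have p_s : p \in s by rewrite (perm_mem Es) mem_head.
have hp := pl_prime sP p_s; have [pB Pp _] := hprime_B hp.
have s'_dk q : q \in s' -> divides q (dk q).
  move=> qs'; have hq := pl_prime sP (s's q qs').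
  have [_ qB Pq q_br] := (hprimeP q kN).1 hq; have [_ _ [t Dq]] := hprime_B hq.
  have q_brr a : a \in B -> divides q (br a q).
    by move=> aB; rewrite (br_anti brP); apply/dividesN/q_br.
  have qp : ~ divides q p.
    move/(prime_divides_prime Pp Pq) => q_p; case/negP: ps'.
    by rewrite -(pl_assoc sP (s's q qs') p_s q_p).
  (* Evaluate at [q] the equation that makes [dk] inner. *)
  have : divides q ((w k)%:MP * p ^+ 2 * dk q).
    have -> : (w k)%:MP * p ^+ 2 * dk q = (p * br (dk p) q - dk p * br p q)
        - D q * p * dk p by rewrite (pole_br polP) //; ring.
    rewrite Dq; apply: dividesB; first apply: dividesB.
    - exact/dividesMl/q_brr/(der_stable (sd_delta sd)).
    - exact/dividesMl/q_brr.
    by do 2!apply: dividesMr; apply/dividesZ/divides_refl.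
  rewrite -mulrA mul_mpolyC => /(dividesZr (sd_lam sd)).
  by case/(prime_elementM Pq) => // /(prime_elementM Pq)[].
have s_dk q : q \in s -> q \notin s' -> ~ divides q (dk q).
  by rewrite (perm_mem Es) inE => /predU1P[-> _|-> //].
have ps : p = 1 \/ (hprime k p /\ ~ divides p (dk p)) by right.
split.
  exists (new_prime k dk w p :: s').
  exact: (prime_list_new polP s's uniq_s' ps s'_dk s_dk).
right; exists p, ((w k)^-1 *: dk p) => y.
have Ey : new_prime k dk w p = w k *: y.
  rewrite /y /new_prime scalerBr scalerA mulfV ?(sd_lam sd) // scale1r.
  by rewrite -mulrA mul_mpolyC.
have yE : y = (w k)^-1 *: new_prime k dk w p.
  by rewrite Ey scalerA mulVf ?(sd_lam sd) // scale1r.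
have s'_nap q : q \in s' -> ~ associated q p.
  move=> qs' /(pl_assoc sP (s's q qs') p_s) Eq.
  by case/negP: ps'; rewrite -Eq.
split=> //.
- by split=> // dp0; apply: pdp; rewrite dp0; apply: divides0.
- split; first by apply/(RsubZ charK)/(der_stable (sd_delta sd)).
  apply: (homogeneousZ actP); have [hom_p _ _ _] := (hprimeP p kN).1 hp.
  have [u ux] := homogeneous_weight actP (cgl_var RCGL k).
  have [v vp] := homogeneous_weight actP hom_p.
  exact: weight_homogeneous (sd_weight sd ux pB vp).
- rewrite yE; apply: hprimeZ; rewrite ?invr_eq0 ?(sd_lam sd) //.
  exact: (hprime_new_prime polP ps).
- move=> c hc c_p; have [q qs [t t0 Ec]] := pl_complete sP hc.
  have qs' : q \in s'.
    move: qs; rewrite (perm_mem Es) inE => /predU1P[qp|//].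
    by case: c_p; exists t; rewrite -?qp.
  rewrite Ec; apply: hprimeZ => //; apply: hprime_next (s'_dk q qs').
  exact/(pl_prime sP)/s's.
move=> c /(hprime_new_cases polP ps s_dk)[cy|[q qs' cq]]; [left|right].
  apply: associated_trans cy _; rewrite Ey.
  by exists (w k); rewrite ?(sd_lam sd).
split; last first.
  by move/(associated_trans (associated_sym cq)); apply: s'_nap.
have [t t0 ->] := cq; apply: hprimeZ => //.
exact/(pl_prime sP)/s's.
Qed.

End OneStep.

Theorem dichotomyP k : dichotomy k.
Proof.
have list_k n : (n <= N)%N -> exists s, prime_list n s.
  elim: n => [|n IHn] nN; first by exists [::]; apply: prime_list0.
  have [s sP] := IHn (ltnW nN).
  have [D [w [ev sd]]] := step_data_exists (Ordinal nN).
  by have [] := one_step sd sP.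
have [s sP] := list_k k (ltnW (ltn_ord k)).
have [D [w [ev sd]]] := step_data_exists k.
by have [] := one_step sd sP.
Qed.

End PrimeLists.

(** * Predecessors, successors and level sets *)

Section LevelSets.
Variable N : nat.
Implicit Types (eta : 'I_N -> int) (i j k l : 'I_N) (n : nat).

Lemma predecessor_SomeP eta k j : predecessor eta k = Some j <->
  [/\ (j < k)%N, eta j = eta k
    & forall i, (j < i)%N -> (i < k)%N -> eta i <> eta k].
Proof.
rewrite /predecessor; set A := [set _ | _]; split.
  case: pickP => // j' /andP[]; rewrite inE => /andP[j'k /eqP Ej'] /forallP max_j' [<-].
  split=> // i j'i ik Ei; have /implyP := max_j' i.
  by rewrite inE ik Ei eqxx leqNgt j'i => /(_ isT).
move=> [jk Ej max_j]; have jA : j \in A by rewrite inE jk Ej eqxx.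
have ub i : i \in A -> (i <= j)%N.
  rewrite inE => /andP[ik /eqP Ei]; rewrite leqNgt; apply/negP => ji.
  exact: max_j Ei.
case: pickP => [j' /andP[j'A /forall_inP max_j']|/(_ j)]; last first.
  by rewrite jA; move/negP; case; apply/forall_inP.
by congr Some; apply/val_inj/eqP; rewrite eqn_leq ub // max_j'.
Qed.

Lemma predecessor_None eta k j : predecessor eta k = None -> (j < k)%N ->
  eta j <> eta k.
Proof.
move=> pk jk Ej; suff [j' /predecessor_SomeP] : exists j', [/\ (j' < k)%N,
    eta j' = eta k & forall i, (j' < i)%N -> (i < k)%N -> eta i <> eta k].
  by rewrite pk.
have Pj : (j < k)%N && (eta j == eta k) by rewrite jk Ej eqxx.
case: (@arg_maxnP _ j [pred i : 'I_N | (i < k)%N && (eta i == eta k)] val Pj).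
move=> j' /andP[j'k /eqP Ej'] max_j'; exists j'; split=> // i j'i ik Ei.
have := max_j' i; rewrite /= ik Ei eqxx => /(_ isT).
by rewrite /= leqNgt j'i.
Qed.

Lemma predecessor_NoneP eta k : predecessor eta k = None <->
  forall j, (j < k)%N -> eta j <> eta k.
Proof.
split=> [pk j|no_j]; first exact: predecessor_None.
case Ek: (predecessor eta k) => [j|] //.
by case/predecessor_SomeP: Ek => /no_j.
Qed.

Lemma succ_gtP eta j n (k : 'I_N) : n = k.+1 ->
  succ_gt eta j k =
  [forall l : 'I_N, (j < l)%N && (l < n)%N ==> (eta l != eta j)].
Proof.
move=> ->; rewrite /succ_gt /successor; set A := [set _ | _]; case: pickP => [l|noA].
  case/andP; rewrite inE => /andP[jl El] /forall_inP min_l.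
  apply/idP/forallP => [kl i|/(_ l)]; last by rewrite jl El ltnS implybF -ltnNge.
  apply/implyP => /andP[ji ik]; apply/negP => Ei.
  have /min_l : i \in A by rewrite inE ji.
  by rewrite leqNgt (leq_trans ik).
apply/esym/forallP => l; apply/implyP => /andP[jl _]; apply/negP => El.
have Pl : (j < l)%N && (eta l == eta j) by rewrite jl El.
have [l' l'A min_l'] :=
  @arg_minnP _ l [pred i : 'I_N | (j < i)%N && (eta i == eta j)] val Pl.
have := noA l'; rewrite [l' \in A]inE [_ && (eta l' == eta j)]l'A /=.
move/negP; case; apply/forall_inP => i; rewrite inE; exact: min_l'.
Qed.

Section SameLevelSets.
Variables eta eta' : 'I_N -> int.
Hypothesis same : forall i j, (eta i == eta j) = (eta' i == eta' j).

Lemma same_predecessor k : predecessor eta k = predecessor eta' k.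
Proof.
rewrite /predecessor; set A := [set _ | _]; set A' := [set _ | _].
by have -> : A = A' by apply/setP => i; rewrite !inE same.
Qed.

Lemma same_successor k : successor eta k = successor eta' k.
Proof.
rewrite /successor; set A := [set _ | _]; set A' := [set _ | _].
by have -> : A = A' by apply/setP => i; rewrite !inE same.
Qed.

Lemma same_partition :
  preim_partition eta [set: 'I_N] = preim_partition eta' [set: 'I_N].
Proof.
apply: eq_imset => i; apply/setP => j; rewrite !inE; exact: same.
Qed.

End SameLevelSets.

(** Level sets are the chains of the predecessor function: descend from the
    larger of two indices in the same level set until reaching the other. *)
Lemma predecessor_level eta eta' :
    (forall k, predecessor eta k = predecessor eta' k) ->
  forall i j, eta i = eta j -> eta' i = eta' j.
Proof.
move=> same i j; wlog ij : i j / (i <= j)%N.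
  by move=> H; case/orP: (leq_total i j) => ij E; [apply: H | apply/esym/H].
move En: (nat_of_ord j) => n; elim/ltn_ind: n => n IHn in j En ij *.
move: ij; rewrite leq_eqVlt => /predU1P[/val_inj -> //|ij Eij].
case Ej: (predecessor eta j) => [l|]; last first.
  by case: (predecessor_None Ej ij).
have [lj El no_l] := (predecessor_SomeP _ _ _).1 Ej.
have [_ El' _] := (predecessor_SomeP _ _ _).1 (etrans (esym (same j)) Ej).
rewrite -El'; apply: (IHn l) => //; first by rewrite -En.
  by rewrite leqNgt; apply/negP => li; apply: (no_l i).
by rewrite El.
Qed.

End LevelSets.

(** * Uniqueness and existence of the prime sequence *)

Section PrimeSequences.
Variables (K : fieldType) (charK : [pchar K] =i pred0) (N r : nat).
Local Notation R := {mpoly K[N]}.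
Variables (br : R -> R -> R) (sigma delta : 'I_N -> R -> R).
Variable (act : {ffun 'I_r -> K} -> R -> R).
Hypothesis RCGL : poisson_CGL br sigma delta act.
Implicit Types (a b p : R) (i j k l : 'I_N) (n : nat) (eta : 'I_N -> int).

Local Notation hprime := (hprime br act).
Local Notation lists n P y :=
  (lists_homogeneous_poisson_primes br act (Rsub N n) P y).

Section Uniqueness.
Variables (eta : 'I_N -> int) (c y : 'I_N -> R).
Hypothesis yP : prime_sequence br act eta c y.

Lemma sequence_hprime k : hprime k.+1 (y k).
Proof.
have [H _] := ps_list yP k; apply: H; rewrite /= leqnn (succ_gtP _ _ erefl).
by apply/forallP => l; rewrite ltnS [(k < l)%N]ltnNge andNb.
Qed.

Lemma sequence_in k : y k \in Rsub N k.+1.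
Proof. by have [_ []] := sequence_hprime k. Qed.

Lemma sequence_mderiv k :
  (y k)^`M(k) = if predecessor eta k is Some j then y j else 1.
Proof.
rewrite (ps_rec yP); case Ek: (predecessor eta k) => [j|]; last first.
  by rewrite mderiv_var eqxx.
have [jk _ _] := (predecessor_SomeP _ _ _).1 Ek.
have [|ck _] := ps_coef yP (k := k); first by rewrite Ek.
have dk b : b \in Rsub N k -> b^`M(k) = 0 by move/(RsubP charK); apply.
rewrite mderivB mderivM mderiv_var eqxx (dk _ ck) dk ?mul0r ?mulr1 ?subr0 ?add0r //.
exact: (Rsub_le charK jk (sequence_in j)).
Qed.

Lemma sequence_mderiv_neq0 k : (y k)^`M(k) != 0.
Proof.
rewrite sequence_mderiv; case: predecessor => [j|]; last exact: oner_neq0.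
by have [_ []] := sequence_hprime j.
Qed.

Lemma sequence_associated i j : associated (y i) (y j) -> i = j.
Proof.
have half i' j' : (i' < j')%N -> ~ associated (y j') (y i').
  move=> ij [t t0 Ej]; case/eqP: (sequence_mderiv_neq0 j').
  rewrite Ej mderivZ; have /(RsubP charK)/(_ j' ij) -> := sequence_in i'.
  by rewrite scaler0.
case: (ltngtP i j) => [ij|ji|/val_inj] // ya.
  by case: (half _ _ ij); apply: associated_sym.
by case: (half _ _ ji).
Qed.

Lemma sequence_prime k : prime_element (y k).
Proof.
by have [_ _ Pk _] := (hprimeP charK RCGL _ (ltn_ord k)).1 (sequence_hprime k).
Qed.

Lemma sequence_step k :
  (predecessor eta k = None /\ y k = 'X_k) \/
  exists2 j, predecessor eta k = Some j & y k = y j * 'X_k - c k.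
Proof.
rewrite (ps_rec yP); case: predecessor => [j|]; by [right; exists j | left].
Qed.

Lemma sequence_not_earlier k : ~ hprime k (y k).
Proof.
case=> _ [/(RsubP charK)/(_ k (leqnn k)) /eqP].
by rewrite (negPf (sequence_mderiv_neq0 k)).
Qed.

(** The derivative of [y k] in the variable of index [k] is [1] or [y j], according
    to the predecessor of [k]; comparing it with that of the only candidate
    determines both. *)
Lemma sequence_variable k :
    (forall a, hprime k.+1 a -> associated a 'X_k \/ hprime k a) ->
  predecessor eta k = None /\ y k = 'X_k.
Proof.
move=> /(_ _ (sequence_hprime k))[[t t0 Ek]|/sequence_not_earlier //].
have [//|[j Ej _]] := sequence_step k.
have := sequence_mderiv k; rewrite Ej Ek mderivZ mderiv_var eqxx => Et.
case: (@prime_const K N t); rewrite -[t%:MP]mulr1 mul_mpolyC Et.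
exact: sequence_prime.
Qed.

Lemma sequence_new_prime k p c0 : p \in Rsub N k -> c0 \in Rsub N k ->
    prime_element p ->
    (forall a, hprime k.+1 a -> associated a (p * 'X_k - c0) \/ hprime k a) ->
  exists j t, [/\ predecessor eta k = Some j, t != 0, y j = t *: p
    & y k = t *: (p * 'X_k - c0)].
Proof.
move=> pk ck Pp /(_ _ (sequence_hprime k))[[t t0 Ek]|/sequence_not_earlier //].
have dk b : b \in Rsub N k -> b^`M(k) = 0 by move/(RsubP charK); apply.
have Ed : (y k)^`M(k) = t *: p.
  rewrite Ek mderivZ mderivB mderivM mderiv_var eqxx !dk //.
  by rewrite mul0r add0r mulr1 subr0.
rewrite sequence_mderiv in Ed.
have [[Ej _]|[j Ej _]] := sequence_step k; rewrite Ej in Ed; last by exists j, t.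
case: (@prime_const K N t^-1); rewrite -[_%:MP]mulr1 mul_mpolyC Ed scalerA.
by rewrite mulVf // scale1r.
Qed.

Lemma sequence_pred_None k :
  predecessor eta k = None <-> (forall b, b \in Rsub N k -> delta k b = 0).
Proof.
have [[dk0 _ _ new]|[p [c0 [[hp dp] [c0k _] _ _ new]]]] := dichotomyP charK RCGL k.
  by split=> // _; case: (sequence_variable new).
have [_ pk Pp _] := (hprimeP charK RCGL p (ltnW (ltn_ord k))).1 hp.
have {}new a : hprime k.+1 a -> associated a (p * 'X_k - c0) \/ hprime k a.
  by case/new => [|[]]; auto.
have [j [t [-> _ _ _]]] := sequence_new_prime pk c0k Pp new.
by split=> // dk0; case: dp; apply: dk0.
Qed.

End Uniqueness.

Lemma sequence_unique eta eta' c c' y y' :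
    prime_sequence br act eta c y -> prime_sequence br act eta' c' y' ->
  forall k, predecessor eta k = predecessor eta' k /\ y k = y' k.
Proof.
move=> yP yP' k; move En: (nat_of_ord k) => n.
elim/ltn_ind: n => n IHn in k En *.
have [[_ _ _ new]|[p [c0 [[hp _] [c0k _] _ _ new]]]] := dichotomyP charK RCGL k.
  have [-> ->] := sequence_variable yP new.
  by have [-> ->] := sequence_variable yP' new.
have [_ pk Pp _] := (hprimeP charK RCGL p (ltnW (ltn_ord k))).1 hp.
have {}new a : hprime k.+1 a -> associated a (p * 'X_k - c0) \/ hprime k a.
  by case/new => [|[]]; auto.
have [j [t [Ej t0 yj yk]]] := sequence_new_prime yP pk c0k Pp new.
have [j' [t' [Ej' t'0 yj' yk']]] := sequence_new_prime yP' pk c0k Pp new.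
have [j'k _ _] := (predecessor_SomeP _ _ _).1 Ej'.
have {}IHn : y j' = y' j' by case: (IHn j' _ j' erefl) => //; rewrite -En.
have jj' : j = j'.
  apply: (sequence_associated yP); rewrite IHn yj' yj; exists (t / t').
    by rewrite mulf_neq0 ?invr_neq0.
  by rewrite scalerA divfK.
have p0 : p != 0 by case: Pp.
have tt' : t = t'.
  apply/eqP; rewrite -subr_eq0; have := yj; rewrite jj' IHn yj' => /eqP.
  by rewrite eq_sym -subr_eq0 -scalerBl scaler_eq0 (negPf p0) orbF.
by rewrite Ej Ej' yk yk' jj' tt'.
Qed.

Lemma same_sequence eta eta' c y :
    (forall i j, (eta i == eta j) = (eta' i == eta' j)) ->
  prime_sequence br act eta c y -> prime_sequence br act eta' c y.
Proof.
move=> same [y_c y_rec y_hom y_list]; split=> // k.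
- by rewrite -(same_predecessor same); apply: y_c.
- by rewrite -(same_predecessor same) y_rec.
have [H1 H2] := y_list k.
have E j : (j <= k)%N && succ_gt eta' j k = (j <= k)%N && succ_gt eta j k.
  by rewrite /succ_gt (same_successor same).
split=> [j|a ha pa].
  by rewrite /= E; apply: H1.
have [j [[Pj aj] Uj]] := H2 a ha pa; exists j; split; first by rewrite /= E.
by move=> j'; rewrite /= E; apply: Uj.
Qed.

Section Existence.

Definition last_below (eta : 'I_N -> int) n : pred 'I_N :=
  [pred j : 'I_N | (j < n)%N &&
    [forall l : 'I_N, (j < l)%N && (l < n)%N ==> (eta l != eta j)]].

Lemma last_belowP eta n j : reflect
  ((j < n)%N /\ forall l, (j < l)%N -> (l < n)%N -> eta l <> eta j)
  (last_below eta n j).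
Proof.
apply: (iffP andP) => [[jn /forallP Hj]|[jn Hj]]; split=> //.
  by move=> l jl ln El; have := Hj l; rewrite jl ln El eqxx.
by apply/forallP => l; apply/implyP => /andP[jl ln]; apply/eqP/Hj.
Qed.

Lemma last_below_succ eta k j :
  (j <= k)%N && succ_gt eta j k = last_below eta k.+1 j.
Proof. by rewrite (succ_gtP _ _ erefl). Qed.

Definition sequence_at (eta : 'I_N -> int) (c y : 'I_N -> R) k : Prop :=
  [/\ predecessor eta k <> None -> c k \in Rsub N k /\ homogeneous act (c k),
      y k = if predecessor eta k is Some j then y j * 'X_k - c k else 'X_k,
      homogeneous act (y k)
    & lists k.+1 (last_below eta k.+1) y].

Lemma sequence_atP eta c y :
  (forall k, sequence_at eta c y k) -> prime_sequence br act eta c y.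
Proof.
move=> H; split=> k; have [Hc Hr Hh Hl] := H k => //.
have [H1 H2] := Hl; split=> [j|a ha pa].
  by rewrite /= last_below_succ; apply: H1.
have [j [Pj Uj]] := H2 a ha pa; exists j; split=> [|j'].
  by rewrite /= last_below_succ.
by rewrite /= last_below_succ; apply: Uj.
Qed.

Lemma lists_ext n (P P' : pred 'I_N) (y y' : 'I_N -> R) :
    P =1 P' -> (forall j, P j -> y j = y' j) ->
  lists n P y -> lists n P' y'.
Proof.
move=> PP' yy' [H1 H2]; split=> [j|a ha pa].
  by rewrite -PP' => Pj; rewrite -yy' //; apply: H1.
have [j [[Pj aj] Uj]] := H2 a ha pa.
exists j; split; first by rewrite -PP' -yy'.
by move=> j'; rewrite -PP' => -[Pj']; rewrite -yy' // => aj'; apply: Uj.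
Qed.

Lemma last_below_local eta eta' n j :
    (forall i, (i < n)%N -> eta i = eta' i) ->
  last_below eta n j = last_below eta' n j.
Proof.
move=> same; apply/last_belowP/last_belowP => -[jn Hj]; split=> // l jl ln.
  by rewrite -!same //; apply: Hj.
by rewrite !same //; apply: Hj.
Qed.

Lemma predecessor_local eta eta' k :
    (forall i, (i <= k)%N -> eta i = eta' i) ->
  predecessor eta k = predecessor eta' k.
Proof.
move=> same; rewrite /predecessor; set A := [set _ | _]; set A' := [set _ | _].
suff -> : A = A' by [].
by apply/setP => i; rewrite !inE; case: ltnP => //= /ltnW ik; rewrite !same.
Qed.

Lemma sequence_at_local eta eta' c c' y y' k :
    (forall i, (i <= k)%N -> [/\ eta i = eta' i, c i = c' i & y i = y' i]) ->
  sequence_at eta c y k -> sequence_at eta' c' y' k.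
Proof.
move=> same; have [_ Ec Ey] := same k (leqnn k).
have Eeta i : (i <= k)%N -> eta i = eta' i by case/same.
rewrite /sequence_at (predecessor_local Eeta) Ec Ey => -[Hc Hr Hh Hl]; split=> //.
  rewrite Hr; case Ej: (predecessor eta' k) => [j|] //.
  have [jk _ _] := (predecessor_SomeP _ _ _).1 Ej.
  by have [_ _ ->] := same j (ltnW jk).
apply: lists_ext Hl => [j|j /last_belowP[jk _]].
  by apply: last_below_local => i; rewrite ltnS; apply: Eeta.
by have [] := same j jk.
Qed.

(** The new list is irredundant because its only element involving the new
    variable is the one of index [k]. *)
Lemma lists_next k (P P' : pred 'I_N) (y y' : 'I_N -> R) :
    lists k P y -> (forall j, P j -> y' j = y j) -> ~~ P k ->
    P' k -> (forall j, P' j -> j <> k -> P j) ->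
    (y' k)^`M(k) != 0 -> (forall j, P' j -> hprime k.+1 (y' j)) ->
    (forall a, hprime k.+1 a -> associated a (y' k) \/
      hprime k a /\ forall j, P j -> associated a (y j) -> P' j) ->
  lists k.+1 P' y'.
Proof.
move=> [H1 H2] yy' Pk P'k P'P dyk Hp Hc; split=> [j|a ha pa]; first exact: Hp.
have dP j : P j -> (y' j)^`M(k) = 0.
  move=> Pj; have [_ [yj _ _ _]] := H1 j Pj.
  by rewrite yy' //; apply: (RsubP charK _ _ yj).
have [[t t0 Ea]|[[_ hka] HP]] := Hc a (conj ha pa).
  exists k; split; first by split=> //; exists t.
  move=> j [P'j [t' t'0 Ea']]; apply/eqP/negPn/negP => /eqP/nesym jk.
  case/eqP: dyk; have := congr1 (mderiv k) Ea; rewrite Ea' !mderivZ dP; last exact: P'P.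
  by move/esym/eqP; rewrite scaler0 scaler_eq0 (negPf t0) => /eqP.
have [j [[Pj aj] Uj]] := H2 a ha hka; exists j; split.
  by split; [exact: HP | rewrite yy'].
move=> j' [P'j' aj']; have [Ej|/eqP j'k] := eqVneq j' k.
  have := aj'; rewrite Ej => -[t t0 Ea]; case/eqP: dyk.
  have ak : a \in Rsub N k by case: hka.
  have := RsubP charK _ _ ak k (leqnn k); rewrite Ea mderivZ => /eqP.
  by rewrite scaler_eq0 (negPf t0) => /eqP.
by apply: Uj; split; [exact: P'P | rewrite -yy' //; apply: P'P].
Qed.

Lemma last_below_next eta k v j :
  last_below (fun i => if i == k then v else eta i) k.+1 j =
  (j == k) || (last_below eta k j && (eta j != v)).
Proof.
have nk i : (i < k)%N -> (i == k) = false.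
  by move=> ik; apply: contraTF ik => /eqP ->; rewrite ltnn.
have [->|jk] := eqVneq j k.
  by apply/last_belowP; split=> // l kl; rewrite ltnS leqNgt kl.
apply/last_belowP/andP => [[j_k Hj]|[/last_belowP[j_k Hj] /eqP jv]].
  have {}j_k : (j < k)%N by rewrite ltn_neqAle jk -ltnS.
  split; first (apply/last_belowP; split=> // l jl lk).
    by have := Hj l jl (leqW lk); rewrite (negPf jk) nk.
  by apply/eqP => jv; apply: (Hj k) => //; rewrite eqxx (negPf jk).
split=> [|l jl]; first exact: leqW.
rewrite (negPf jk); case: eqVneq => [_ _ /esym //|lk l_k].
by apply: Hj => //; rewrite ltn_neqAle lk -ltnS.
Qed.

(** The bound on [e] makes the value [k] available to start a new level set. *)
Lemma sequence_exists_upto n : (n <= N)%N ->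
  exists (e : 'I_N -> nat) (c y : 'I_N -> R),
  let eta i := Posz (e i) in
  [/\ forall i, (i < n)%N -> (e i <= i)%N,
      forall i, (i < n)%N -> sequence_at eta c y i
    & lists n (last_below eta n) y].
Proof.
elim: n => [|n IHn] nN.
  exists (fun=> 0%N), (fun=> 0), (fun=> 0); split=> //; split=> [j /andP[] //|a ha pa].
  have [_ /(Rsub0_const charK)[t ->] Pt _] := (hprimeP charK RCGL a (leq0n N)).1 (conj ha pa).
  by case: (prime_const Pt).
have [e [c [y [e_le y_at y_list]]]] := IHn (ltnW nN).
pose k := Ordinal nN; set eta := fun i => Posz (e i) in y_at y_list.
have extend v ck yk :
    let eta' i := if i == k then Posz v else eta i in
    let c' i := if i == k then ck else c i in
    let y' i := if i == k then yk else y i in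
    (v <= n)%N -> sequence_at eta' c' y' k ->
    exists (e : 'I_N -> nat) (c y : 'I_N -> R), let eta i := Posz (e i) in
    [/\ forall i, (i < n.+1)%N -> (e i <= i)%N,
        forall i, (i < n.+1)%N -> sequence_at eta c y i
      & lists n.+1 (last_below eta n.+1) y].
  move=> eta' c' y' vn at_k; exists (fun i => if i == k then v else e i), c', y'.
  have Eeta i : Posz (if i == k then v else e i) = eta' i.
    by rewrite /eta' /eta; case: eqP.
  have at_k' : sequence_at (fun i => Posz (if i == k then v else e i)) c' y' k.
    by apply: sequence_at_local at_k.
  have ltk i : (i < n.+1)%N -> i != k -> (i < n)%N.
    by rewrite ltnS leq_eqVlt => /predU1P[Ei|//]; rewrite -val_eqE /= Ei eqxx.
  split; last by case: at_k'.
    by move=> i i_n; case: (altP (i =P k)) => [->//|ik]; apply/e_le/ltk.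
  move=> i i_n; have [->|ik] := eqVneq i k; first exact: at_k'.
  apply: sequence_at_local (y_at i (ltk i i_n ik)) => l li.
  have lk : l != k by rewrite -val_eqE /= neq_ltn (leq_ltn_trans li) ?ltk.
  by rewrite Eeta /eta' /c' /y' (negPf lk).
have nlk i : (i < n)%N -> (i == k) = false.
  by move=> i_n; apply: contraTF i_n => /eqP ->; rewrite ltnn.
have not_last : ~~ last_below eta n k by apply/last_belowP => -[]; rewrite ltnn.
have y_list_k : lists k (last_below eta k) y := y_list.
have last_lt j : last_below eta n j -> (j < n)%N by case/last_belowP.
have [[dk0 hx old new]|[p [c0 [[hp dp] [c0k hc0] hy old new]]]] :=
  dichotomyP charK RCGL k.
  apply: (extend n 0 'X_k) => //; set eta' := fun i => if i == k then _ else _.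
  have fresh j : (j < n)%N -> eta j <> n.
    by move=> jn [En]; have := e_le j jn; rewrite En leqNgt jn.
  have pk : predecessor eta' k = None.
    by apply/predecessor_NoneP => j jk; rewrite /eta' eqxx nlk //; apply: fresh.
  rewrite /sequence_at pk eqxx; split=> //; first by case: hx.
  apply: (lists_next y_list_k _ not_last) => [j /last_lt/nlk -> //||j||j|a].
  - by rewrite /eta' last_below_next eqxx.
  - by rewrite /eta' last_below_next => /orP[/eqP //|/andP[]].
  - by rewrite eqxx mderiv_var eqxx oner_neq0.
  - rewrite /eta' last_below_next; case: eqVneq => [_ _|_ /andP[Pj _]]; first exact: hx.
    by apply: old; apply: (y_list.1).
  rewrite eqxx => /new[|ha]; [by left | right; split=> // j Pj _].
  by rewrite /eta' last_below_next Pj; apply/orP; right; apply/eqP/fresh/last_lt.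
have [hom_p pp] := hp.
have [j0 [[Pj0 [t t0 Ep]] Uj0]] := y_list.2 p hom_p pp.
have [j0n Hj0] := last_belowP _ _ _ Pj0.
have j0_eq j : last_below eta n j -> associated p (y j) -> j0 = j.
  by move=> Pj pj; apply: Uj0.
pose yk := y j0 * 'X_k - t^-1 *: c0.
have ykE : yk = t^-1 *: (p * 'X_k - c0).
  by rewrite scalerBr Ep -scalerAl scalerA mulVf // scale1r.
have t'0 : t^-1 != 0 by rewrite invr_eq0.
have hyk : hprime k.+1 yk by rewrite ykE; apply: (hprimeZ charK RCGL).
apply: (extend (e j0) (t^-1 *: c0) yk); first exact: leq_trans (e_le _ j0n) (ltnW j0n).
set eta' := fun i => if i == k then _ else _.
have pk : predecessor eta' k = Some j0.
  apply/predecessor_SomeP; rewrite /eta' eqxx nlk //; split=> // i j0i ik.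
  by rewrite nlk //; apply: Hj0.
have lastE j : last_below eta' k.+1 j =
    (j == k) || (last_below eta n j && (j != j0)).
  rewrite last_below_next; congr (_ || _).
  have [Pj /=|//] := boolP (last_below eta k j); congr negb.
  apply/eqP/eqP => [Ej|-> //]; have [jn Hj] := last_belowP _ _ _ Pj.
  case: (ltngtP j j0) => [jj0|j0j|/val_inj] //.
    by case: (Hj j0 jj0 j0n).
  by case: (Hj0 j j0j jn).
rewrite /sequence_at pk eqxx nlk //; split=> //.
- by split; [exact: (RsubZ charK) | exact: (homogeneousZ (cgl_action RCGL))].
- by case: hyk.
apply: (lists_next y_list_k _ not_last) => [j /last_lt/nlk -> //||j||j|a].
- by rewrite lastE eqxx.
- by rewrite lastE => /orP[/eqP //|/andP[]].
- have dk b : b \in Rsub N k -> b^`M(k) = 0 by move/(RsubP charK); apply.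
  have [yj0 yj00 _ _] := (y_list.1 j0 Pj0).2.
  rewrite eqxx /yk mderivB mderivM mderivZ mderiv_var eqxx !dk //.
  by rewrite mul0r add0r mulr1 scaler0 subr0.
- rewrite lastE; case: eqVneq => [_ _|_ /andP[Pj jj0]]; first exact: hyk.
  apply: old; first exact: (y_list.1).
  by move/associated_sym/(j0_eq _ Pj)/esym/eqP; apply/negP.
rewrite eqxx => /new[ay|[ha ap]]; [left | right; split=> // j Pj aj].
  by apply: associated_trans ay _; rewrite ykE; apply: associated_sym; exists t^-1.
rewrite lastE Pj; apply/orP; right; apply/eqP => jj0; apply: ap.
by apply: associated_trans aj _; rewrite jj0; apply: associated_sym; exists t.
Qed.

Lemma sequence_exists : exists eta c y, prime_sequence br act eta c y.
Proof.
have [e [c [y [_ y_at _]]]] := sequence_exists_upto (leqnn N).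
by exists (fun i => Posz (e i)), c, y; apply: sequence_atP => k; apply: y_at.
Qed.

End Existence.

End PrimeSequences.

Theorem theorem5p5 (K : fieldType) (charK : [pchar K] =i pred0)
    (N r : nat) (N_gt0 : (0 < N)%N)
    (br : {mpoly K[N]} -> {mpoly K[N]} -> {mpoly K[N]})
    (sigma delta : 'I_N -> {mpoly K[N]} -> {mpoly K[N]})
    (act : {ffun 'I_r -> K} -> {mpoly K[N]} -> {mpoly K[N]})
    (RCGL : poisson_CGL br sigma delta act) :
  (exists (eta : 'I_N -> int) (c y : 'I_N -> {mpoly K[N]}),
     prime_sequence br act eta c y) /\
  (forall (eta : 'I_N -> int) (c y : 'I_N -> {mpoly K[N]}),
     prime_sequence br act eta c y ->
     forall k : 'I_N,
       [/\ homogeneous act (y k),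
           poisson_prime br (Rsub N k.+1) (y k)
         & prime_element (y k)]) /\
  (forall (eta eta' : 'I_N -> int) (c c' y y' : 'I_N -> {mpoly K[N]}),
     prime_sequence br act eta c y -> prime_sequence br act eta' c' y' ->
     forall k : 'I_N, y k = y' k) /\
  (exists eta eta' : 'I_N -> int,
     [/\ admissible br act eta, admissible br act eta'
       & exists k : 'I_N, eta k <> eta' k]) /\
  (forall eta eta' : 'I_N -> int,
     admissible br act eta -> admissible br act eta' ->
     [/\ preim_partition eta [set: 'I_N] = preim_partition eta' [set: 'I_N],
         forall k : 'I_N, predecessor eta k = predecessor eta' k
       & forall k : 'I_N, successor eta k = successor eta' k]) /\
  (forall eta : 'I_N -> int,
     admissible br act eta ->
     forall k : 'I_N,
       predecessor eta k = None <->
       (forall b, b \in Rsub N k -> delta k b = 0)).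
Proof.
have prime_at eta c y : prime_sequence br act eta c y ->
    forall k : 'I_N, hprime br act k.+1 (y k).
  by move=> yP k; exact: (sequence_hprime yP).
have same eta eta' : admissible br act eta -> admissible br act eta' ->
    forall k, predecessor eta k = predecessor eta' k.
  move=> [c [y yP]] [c' [y' yP']] k.
  by have [] := sequence_unique charK RCGL yP yP' k.
split; first exact: (sequence_exists charK RCGL).
split.
  move=> eta c y yP k; have [hom_y prime_y] := prime_at eta c y yP k.
  by split=> //; apply: (sequence_prime charK RCGL yP).
split.
  move=> eta eta' c c' y y' yP yP' k.
  by have [] := sequence_unique charK RCGL yP yP' k.
split.
  have [eta [c [y yP]]] := sequence_exists charK RCGL.
  exists eta, (fun i => eta i + 1); split.
  - by exists c, y.
  - by exists c, y; apply: same_sequence yP => i j; rewrite (inj_eq (addIr _)).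
  exists (Ordinal N_gt0) => /eqP.
  by rewrite -subr_eq0 opprD addrA subrr sub0r oppr_eq0 oner_eq0.
split.
  move=> eta eta' eta_ok eta'_ok; have Ep := same _ _ eta_ok eta'_ok.
  have level i j : (eta i == eta j) = (eta' i == eta' j).
    by apply/eqP/eqP; apply: predecessor_level => // k; rewrite Ep.
  by split; [exact: same_partition | exact: Ep | exact: same_successor].
move=> eta [c [y yP]] k; exact: (sequence_pred_None charK RCGL yP).
Qed.
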